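(* There is a quantum algorithm that evaluates an AND-OR-NOT DAG $G=(V,E)$ with running time $O(\sqrt{\hat{n}m\log\hat{n}})=O(\sqrt{nm\log n})$ and error probability $O(1/\hat{n})$, where $m=|E|$, $n=|V|$, $\hat{n}=n-|L|$ and $L$ is the set of sinks.
   Context: An AND-OR-NOT DAG is a directed acyclic graph $G=(V,E)$, $V=\{v_1,\dots,v_n\}$, given in the adjacency list model (arrays $D_i$ of out-neighbours of $v_i$, $d_i=|D_i|$), topologically sorted (each edge $(v_i,v_j)$ has $i<j$) with sinks being the last $|L|$ vertices, such that: each sink is labeled with a Boolean variable (variable-vertices); there is no vertex with $d_i=1$; each vertex with $d_i\ge2$ is labeled with $AND$ or $OR$ (function-vertices); each edge $(v_i,v_j)$ is labeled with $\sigma(i,j)\in\{0,1\}$; and there is one designated root vertex $v_s$. Its value is computed as follows: $r_i$ is the value of the variable for a variable-vertex $v_i$; for a function-vertex $v_i$ labeled $h_i$, $r_i=h_i(r_{j_1}^{\sigma(i,j_1)},\dots,r_{j_w}^{\sigma(i,j_w)})$ where $(v_{j_1},\dots,v_{j_w})=D_i$, $x^1=x$ and $x^0=\neg x$. Evaluating the DAG means computing $r_s$. Query model: the algorithm accesses the graph, labels and variable values through a black-box oracle; running time is the number of queries. *)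

(* Defs.v *)
From HB Require Import structures.
From mathcomp Require Import all_boot all_order all_algebra.
From mathcomp Require Import spectral complex.
From mathcomp Require Import reals exp.

Set Implicit Arguments.
Unset Strict Implicit.
Unset Printing Implicit Defensive.

Import Order.TTheory GRing.Theory Num.Theory.
Local Open Scope ring_scope.
Local Open Scope sesquilinear_scope.

(** * AND-OR-NOT DAGs *)

Inductive vlabel (k : nat) := LAnd | LOr | LVar of 'I_k.
Arguments LAnd {k}.
Arguments LOr {k}.

Definition is_var k (l : vlabel k) : bool := if l is LVar _ then true else false.

(* Vertices are 0-based, and [k] is the number of Boolean variables; two sinks
   may carry the same variable.  [sigma i j] is only meaningful when (i, j) is
   an edge; [true] stands for 1. *)
Record aon_dag (n k : nat) := AonDag {
  out : 'I_n -> seq 'I_n;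
  label : 'I_n -> vlabel k;
  sigma : 'I_n -> 'I_n -> bool;
  root : 'I_n;
  out_uniq : forall i, uniq (out i);
  out_topo : forall i j : 'I_n, j \in out i -> (i < j)%N;
  sinks_last : forall i j : 'I_n, (i < j)%N -> out i = [::] -> out j = [::];
  out_neq1 : forall i, size (out i) <> 1%N;
  label_sink : forall i, is_var (label i) <-> out i = [::]
}.

Section Dag.
Variables (n k : nat) (G : aon_dag n k).

Definition edges : {set 'I_n * 'I_n} := [set e | e.2 \in out G e.1].
Definition sinks : {set 'I_n} := [set i | out G i == [::]].

Definition nb_edges : nat := #|edges|.
(* \hat n = n - |L| *)
Definition nb_internal : nat := (n - #|sinks|)%N.

(* b^1 = b and b^0 = ~ b *)
Definition signed (s b : bool) : bool := if s then b else ~~ b.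

Variable x : 'I_k -> bool.

(* Recursion on a fuel; a fuel of [n] suffices since indices increase along
   edges, see [valueE]. *)
Fixpoint value_fuel (fuel : nat) (i : 'I_n) : bool :=
  if fuel is f.+1 then
    match label G i with
    | LVar v => x v
    | LAnd => all (fun j => signed (sigma G i j) (value_fuel f j)) (out G i)
    | LOr => has (fun j => signed (sigma G i j) (value_fuel f j)) (out G i)
    end
  else false.

Definition value (i : 'I_n) : bool := value_fuel n i.

Definition dag_value : bool := value (root G).

Lemma value_fuel_stable f g (i : 'I_n) :
  (n - i <= f)%N -> (n - i <= g)%N -> value_fuel f i = value_fuel g i.
Proof.
elim: f g i => [|f IH] [|g] i.
- by [].
- by rewrite leqNgt subn_gt0 ltn_ord.
- by move=> _; rewrite leqNgt subn_gt0 ltn_ord.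
move=> hf hg /=.
have E j : j \in out G i -> value_fuel f j = value_fuel g j.
  move=> /out_topo ij; have jn := ltn_ord j.
  have lt : (n - j < n - i)%N by rewrite ltn_sub2l // (ltn_trans ij).
  by apply: IH; rewrite -ltnS; apply: leq_trans lt _.
case: (label G i) => [||v] //; [apply: eq_in_all|apply: eq_in_has] => j ji /=;
  by rewrite E.
Qed.

Lemma valueE (i : 'I_n) :
  value i = match label G i with
            | LVar v => x v
            | LAnd => all (fun j => signed (sigma G i j) (value j)) (out G i)
            | LOr => has (fun j => signed (sigma G i j) (value j)) (out G i)
            end.
Proof.
by rewrite /value (@value_fuel_stable n n.+1) ?leq_subr // leqW // leq_subr.
Qed.

End Dag.

(** * The black-box oracle *)

(* [QNbr i p] asks for the entry of index [p] of the array D_i. *)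
Inductive query (n k : nat) :=
  | QRoot
  | QDeg of 'I_n
  | QNbr of 'I_n & 'I_n
  | QLabel of 'I_n
  | QSigma of 'I_n & 'I_n
  | QVar of 'I_k.
Arguments QRoot {n k}.
Arguments QDeg {n k}.
Arguments QNbr {n k}.
Arguments QLabel {n k}.
Arguments QSigma {n k}.
Arguments QVar {n k}.

Section QueryFin.
Variables n k : nat.

Let code : Type := (unit + 'I_n + 'I_n * 'I_n + 'I_n + 'I_n * 'I_n + 'I_k)%type.

Definition query_code (q : query n k) : code :=
  match q with
  | QRoot => inl (inl (inl (inl (inl tt))))
  | QDeg i => inl (inl (inl (inl (inr i))))
  | QNbr i p => inl (inl (inl (inr (i, p))))
  | QLabel i => inl (inl (inr i))
  | QSigma i j => inl (inr (i, j))
  | QVar v => inr v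
  end.

Definition query_decode (c : code) : query n k :=
  match c with
  | inl (inl (inl (inl (inl _)))) => QRoot
  | inl (inl (inl (inl (inr i)))) => QDeg i
  | inl (inl (inl (inr (i, p)))) => QNbr i p
  | inl (inl (inr i)) => QLabel i
  | inl (inr (i, j)) => QSigma i j
  | inr v => QVar v
  end.

Lemma query_codeK : cancel query_code query_decode.
Proof. by case. Qed.

HB.instance Definition _ := Finite.copy (query n k) (can_type query_codeK).

End QueryFin.

(* Answers are residues modulo (maxn n k) + 2, which is large enough for every
   number below to be represented faithfully. *)
Notation answer n k := 'I_(maxn n k).+2.

(* Out-of-range positions in D_i are answered by [n], which is no vertex. *)
Definition oracle_nat n k (G : aon_dag n k) (x : 'I_k -> bool)
    (q : query n k) : nat :=
  match q with
  | QRoot => root G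
  | QDeg i => size (out G i)
  | QNbr i p => nth n (map val (out G i)) p
  | QLabel i => match label G i with
                | LAnd => 0
                | LOr => 1
                | LVar v => v.+2
                end
  | QSigma i j => sigma G i j
  | QVar v => x v
  end.

Definition oracle n k (G : aon_dag n k) (x : 'I_k -> bool) (q : query n k) :
  answer n k := inord (oracle_nat G x q).

(** * Quantum query algorithms *)

(* Basis states |q, a, w> of the query, answer and work registers. *)
Notation basis n k W := (query n k * answer n k * W)%type.

Section Quantum.
Variables (R : realType) (n k : nat).

Section Programs.
Variable W : finType.

Local Notation N := #|{: basis n k W}|.

(* Adaptive programs: input-independent unitaries, queries, and projective
   measurements of a function [f] of the basis state whose outcome decides how
   to go on. *)
Inductive program : Type :=
  | Output of bool
  | Gate (U : 'M[R[i]]_N) of U \is unitarymx & program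
  | Query of program
  | Measure (r : nat) (f : basis n k W -> 'I_r) of ('I_r -> program).

Definition ket (b : basis n k W) : 'cV[R[i]]_N :=
  \col_i (enum_val i == b)%:R.

(* |q, a, w> |-> |q, a + O(q), w> *)
Definition oracle_step (O : query n k -> answer n k) (b : basis n k W) :
  basis n k W := let: (q, a, w) := b in (q, a + O q, w).

Definition oracle_mx (O : query n k -> answer n k) : 'M[R[i]]_N :=
  \matrix_(i, j) (enum_val i == oracle_step O (enum_val j))%:R.

Definition project r (f : basis n k W -> 'I_r) (o : 'I_r) (psi : 'cV[R[i]]_N) :
  'cV[R[i]]_N := \col_i (if f (enum_val i) == o then psi i 0 else 0).

Definition sqnorm (psi : 'cV[R[i]]_N) : R :=
  \sum_i (complex.Re (psi i 0) ^+ 2 + complex.Im (psi i 0) ^+ 2).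

(* States are not renormalised after a measurement: the squared norm of the
   current state is the probability of the outcomes observed so far. *)
Fixpoint prob_output (O : query n k -> answer n k) (p : program)
    (psi : 'cV[R[i]]_N) (b : bool) : R :=
  match p with
  | Output c => if c == b then sqnorm psi else 0
  | Gate U _ p' => prob_output O p' (U *m psi) b
  | Query p' => prob_output O p' (oracle_mx O *m psi) b
  | Measure r f p' => \sum_(o < r) prob_output O (p' o) (project f o psi) b
  end.

(* The maximal number of queries over all sequences of measurement outcomes of
   nonzero probability. *)
Fixpoint nb_queries (O : query n k -> answer n k) (p : program)
    (psi : 'cV[R[i]]_N) : nat :=
  match p with
  | Output _ => 0%N
  | Gate U _ p' => nb_queries O p' (U *m psi)
  | Query p' => (nb_queries O p' (oracle_mx O *m psi)).+1
  | Measure r f p' =>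
      \max_(o < r | project f o psi != 0) nb_queries O (p' o) (project f o psi)
  end.

Lemma sqnorm_reindex (h : basis n k W -> basis n k W) (psi : 'cV[R[i]]_N) :
  bijective h ->
  sqnorm ((\matrix_(i, j) (enum_val i == h (enum_val j))%:R) *m psi) =
  sqnorm psi.
Proof.
move=> hb; rewrite /sqnorm.
pose h' (i : 'I_N) : 'I_N := enum_rank (h (enum_val i)).
have h'b : bijective h'.
  apply: bij_comp; last exact: bij_comp hb (enum_val_bij _).
  exact: enum_rank_bij.
rewrite (reindex h') /=; last exact: onW_bij.
apply: eq_bigr => i _; rewrite !mxE.
have -> : \sum_j (\matrix_(i, j) (enum_val i == h (enum_val j))%:R) (h' i) j
    * psi j 0 = psi i 0 :> R[i].
  rewrite (bigD1 i) //= big1 ?addr0 => [|j ji]; rewrite !mxE /h' enum_rankK.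
    by rewrite eqxx mul1r.
  case: eqP => [/(bij_inj hb)/enum_val_inj ij|_]; last by rewrite mul0r.
  by rewrite ij eqxx in ji.
by [].
Qed.

Lemma sqnormE (psi : 'cV[R[i]]_N) :
  (sqnorm psi)%:C%C = ((psi ^t* ) *m psi) 0 0.
Proof.
rewrite /sqnorm rmorph_sum mxE; apply: eq_bigr => i _.
by rewrite /= -[LHS]/(real_complex R _) add_Re2_Im2 !mxE mulrC -normCK.
Qed.

Lemma sqnorm_unitary (U : 'M[R[i]]_N) (psi : 'cV[R[i]]_N) :
  U \is unitarymx -> sqnorm (U *m psi) = sqnorm psi.
Proof.
move=> Uu; apply: (@complexI R); rewrite !sqnormE.
have -> : (U *m psi) ^t* = (psi ^t* ) *m (U ^t* ) by rewrite trmx_mul map_mxM.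
by rewrite mulmxA -(mulmxA (psi ^t* )) -invmx_unitary // mulVmx
  ?unitarymx_unit // mulmx1.
Qed.

Lemma sqnorm_oracle O (psi : 'cV[R[i]]_N) :
  sqnorm (oracle_mx O *m psi) = sqnorm psi.
Proof.
apply: (@sqnorm_reindex (oracle_step O)).
exists (oracle_step (fun q => - O q)) => -[[q a] w] /=.
  by rewrite addrK.
by rewrite subrK.
Qed.

Lemma sqnorm_project r (f : basis n k W -> 'I_r) (psi : 'cV[R[i]]_N) :
  \sum_o sqnorm (project f o psi) = sqnorm psi.
Proof.
rewrite /sqnorm exchange_big; apply: eq_bigr => i _ /=.
rewrite (bigD1 (f (enum_val i))) //= big1 ?addr0 => [|o ne]; rewrite !mxE.
  by rewrite eqxx.
by rewrite eq_sym (negPf ne) /= expr0n addr0.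
Qed.

Lemma prob_output_total O (p : program) (psi : 'cV[R[i]]_N) :
  prob_output O p psi true + prob_output O p psi false = sqnorm psi.
Proof.
elim: p psi => [c|U Uu p IH|p IH|r f p IH] psi /=.
- by case: c; rewrite ?addr0 ?add0r.
- by rewrite IH sqnorm_unitary.
- by rewrite IH sqnorm_oracle.
by rewrite -big_split -(sqnorm_project f); apply: eq_bigr => o _; rewrite /= IH.
Qed.

Lemma sqnorm_ket (b : basis n k W) : sqnorm (ket b) = 1.
Proof.
rewrite /sqnorm (bigD1 (enum_rank b)) //= big1 ?addr0 => [|i ne]; rewrite !mxE.
  by rewrite enum_rankK eqxx /= expr1n expr0n addr0.
case: eqP => [ib|_]; last by rewrite /= expr0n addr0.
by rewrite -ib enum_valK eqxx in ne.
Qed.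

End Programs.

Record quantum_algorithm := QuantumAlgorithm {
  work : finType;
  init : basis n k work;
  code : program work
}.

Definition running_time (A : quantum_algorithm) (G : aon_dag n k)
    (x : 'I_k -> bool) : nat :=
  nb_queries (oracle G x) (code A) (ket (init A)).

Definition error_probability (A : quantum_algorithm) (G : aon_dag n k)
    (x : 'I_k -> bool) : R :=
  prob_output (oracle G x) (code A) (ket (init A)) (~~ dag_value G x).

End Quantum.

(* Main.v *)
From HB Require Import structures.
From mathcomp Require Import all_boot all_order all_algebra.
From mathcomp Require Import spectral complex.
From mathcomp Require Import reals exp.
From mathcomp Require Import perm ring lra.
From mathcomp Require Import topology normedtype derive trigo.
Require Import Defs.

(** The [nhat] function-vertices are evaluated from the last to the first, each
    value being kept in a classical table.  A vertex of out-degree [d] is a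
    search, among its [d] signed children, for one that forces its value.  With
    [t0 ~ log nhat], this search errs with probability at most [4 ^- t0] after
    [O(sqrt (d * t0))] queries (Buhrman, Cleve, de Wolf and Zalka): for every
    [t <= t0], one run of Grover's algorithm that is exact when there are [t]
    marked children (the initial amplitude is damped so that [2 K + 1] rotations
    reach the marked subspace exactly), which costs [sum_t sqrt (d / t)] in
    total; then [6 t0] runs with a random number of at most [sqrt (d / t0)]
    iterations, each of which misses with probability at most 3/4 if more than
    [t0] children are marked.  The error is at most [nhat * 4 ^- t0] by the union
    bound, and Cauchy-Schwarz bounds the sum of the costs. *)

Import numFieldNormedType.Exports.
Import Order.TTheory GRing.Theory Num.Theory.

Set Implicit Arguments.
Unset Strict Implicit.
Unset Printing Implicit Defensive.

Local Open Scope ring_scope.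
Local Open Scope sesquilinear_scope.

(** * Real superpositions and gates *)

Section Gates.
Variables (R : realType) (n k : nat) (W : finType).
Local Notation B := (basis n k W).
Local Notation N := #|{: B}|.
Local Notation ket := (@ket R n k W).

Lemma mul_mx_ket m (A : 'M[R[i]]_(m, N)) (b : B) i :
  (A *m ket b) i 0 = A i (enum_rank b).
Proof.
rewrite !mxE (bigD1 (enum_rank b)) //= big1 ?addr0 => [|j jb].
  by rewrite !mxE enum_rankK eqxx mulr1.
rewrite !mxE; case: eqP => [jE|_]; last by rewrite mulr0.
by rewrite -jE enum_valK eqxx in jb.
Qed.

Lemma enum_val_eq (T : finType) (b : T) (i : 'I_#|{: T}|) :
  (enum_val i == b) = (i == enum_rank b).
Proof. by rewrite -(inj_eq enum_val_inj) enum_rankK. Qed.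

(** For [h := oracle_step O] this is [oracle_mx O], so queries and classical reversible gates share
    the lemmas on their action. *)
Definition perm_gate (h : B -> B) : 'M[R[i]]_N :=
  \matrix_(i, j) (enum_val i == h (enum_val j))%:R.

Lemma perm_gate_ket h b : perm_gate h *m ket b = ket (h b).
Proof.
by apply/colP => i; rewrite mul_mx_ket !mxE enum_rankK.
Qed.

Lemma perm_gate_unitary h : injective h -> perm_gate h \is unitarymx.
Proof.
move=> hI; rewrite -trmx_unitary; apply/unitarymxP/matrixP => i j.
rewrite !mxE (bigD1 (enum_rank (h (enum_val i)))) //= big1 ?addr0 => [|l li].
  rewrite !mxE enum_rankK eqxx mul1r (inj_eq hI) (inj_eq enum_val_inj).
  by case: eqP => _; rewrite ?rmorph1 ?rmorph0.
rewrite !mxE; case: eqP => [lE|_]; last by rewrite mul0r.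
by rewrite -lE enum_valK eqxx in li.
Qed.

Definition phase_gate (f : B -> bool) : 'M[R[i]]_N :=
  diag_mx (\row_i (-1) ^+ f (enum_val i)).

Lemma phase_gate_ket f b : phase_gate f *m ket b = (-1) ^+ f b *: ket b.
Proof.
apply/colP => i; rewrite mul_mx_ket !mxE -(inj_eq enum_val_inj) enum_rankK.
by case: eqP => [->|_]; rewrite ?mulr1n ?mulr1 ?mulr0n ?mulr0.
Qed.

Lemma phase_gate_unitary f : phase_gate f \is unitarymx.
Proof.
apply/unitarymxP; rewrite tr_diag_mx map_diag_mx mulmx_diag.
apply/matrixP => i j; rewrite !mxE; congr (_ *+ _).
by case: (f _); rewrite /= ?expr1 ?expr0 ?rmorphN ?rmorph1 ?mulrNN mulr1.
Qed.

(** The Householder reflection: it negates [v] and fixes what is orthogonal to [v]. Dividing by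
    [sqnorm v] spares normalising the vectors, such as the difference used in [prepare]. *)
Definition reflect_gate (v : 'cV[R[i]]_N) : 'M[R[i]]_N :=
  1%:M - (2 / sqnorm v)%:C%C *: (v *m v ^t*).

(* The reflection along the null vector is the identity, because [2 / 0 = 0]. *)
Lemma reflect_gate_unitary v : reflect_gate v \is unitarymx.
Proof.
have vvA : (v *m v ^t*) ^t* = v *m v ^t*.
  apply/matrixP => i j; rewrite !mxE rmorph_sum; apply: eq_bigr => l _.
  by rewrite !mxE rmorphM /= conjCK mulrC.
have vv2 : (v *m v ^t*) *m (v *m v ^t*) = (sqnorm v)%:C%C *: (v *m v ^t*).
  rewrite mulmxA -(mulmxA v) [v ^t* *m v]mx11_scalar -sqnormE.
  by rewrite mul_mx_scalar scalemxAl.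
apply/unitarymxP; rewrite /reflect_gate.
set c := (2 / _)%:C%C.
have cE : c * (c * (sqnorm v)%:C%C) = 2 * c.
  rewrite /c -!rmorphM /=; case: (eqVneq (sqnorm v) 0) => [->|nz].
    by rewrite invr0 !(mulr0, mul0r).
  by rewrite divfK // rmorphM /= mulrC rmorph_nat.
(* The gate is Hermitian, so unitarity reduces to its square being the identity, which [vv2] and
   [cE] give. *)
have -> : (1%:M - c *: (v *m v ^t*)) ^t* = 1%:M - c *: (v *m v ^t*).
  rewrite linearB /= trmx1 linearZ /= map_mxB map_mx1 map_mxZ vvA.
  by congr (_ - _ *: _); apply: conjc_real.
rewrite mulmxBl mul1mx mulmxBr mulmx1 -scalemxAl -scalemxAr vv2 !scalerA.
rewrite -mulrA cE mulr_natl -scalerMnl mulr2n opprB.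
by rewrite addrK subrK.
Qed.

Section Superposition.
Variable I : finType.

(** All gates used below keep the coefficients real. Permutations act on the labels [x] only, phases
    and reflections on the coefficients only. *)
Definition superposition (x : I -> B) (alpha : I -> R) : 'cV[R[i]]_N :=
  \sum_p (alpha p)%:C%C *: ket (x p).

Lemma eq_superposition x y (al be : I -> R) :
  x =1 y -> al =1 be -> superposition x al = superposition y be.
Proof. by move=> xy ab; apply: eq_bigr => p _; rewrite xy ab. Qed.

Lemma perm_gate_superposition h x al :
  perm_gate h *m superposition x al = superposition (h \o x) al.
Proof.
rewrite mulmx_sumr; apply: eq_bigr => p _.
by rewrite -scalemxAr perm_gate_ket.
Qed.

Lemma phase_gate_superposition f x al :
  phase_gate f *m superposition x al =
  superposition x (fun p => (-1) ^+ f (x p) * al p).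
Proof.
rewrite mulmx_sumr; apply: eq_bigr => p _.
rewrite -scalemxAr phase_gate_ket scalerA mulrC rmorphM /=.
by case: (f _); rewrite ?expr1 ?expr0 ?rmorphN ?rmorph1.
Qed.

Definition dot (al be : I -> R) : R := \sum_p al p * be p.

Lemma superposition_dot x al be : injective x ->
  (superposition x al) ^t* *m superposition x be = (dot al be)%:C%C%:M.
Proof.
move=> xI; apply/matrixP => i j; rewrite !ord1 mxE [RHS]mxE eqxx mulr1n.
transitivity (\sum_l \sum_p \sum_q (al p * be q)%:C%C *
    ((l == enum_rank (x p))%:R * (l == enum_rank (x q))%:R) : R[i]).
  apply: eq_bigr => l _; rewrite !mxE !summxE rmorph_sum mulr_suml.
  apply: eq_bigr => p _; rewrite mulr_sumr; apply: eq_bigr => q _.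
  rewrite !mxE !enum_val_eq !rmorphM /= rmorph_nat.
  have -> : ((al p)%:C%C)^* = (al p)%:C%C by apply: conjc_real.
  ring.
rewrite exchange_big /dot rmorph_sum; apply: eq_bigr => p _.
rewrite exchange_big (bigD1 p) //= [X in _ + X]big1 ?addr0 => [|q qp].
  rewrite (bigD1 (enum_rank (x p))) //= big1 ?addr0 => [|l lp].
    by rewrite eqxx !mulr1.
  by rewrite (negPf lp) mul0r mulr0.
apply: big1 => l _; case: eqP => [->|_]; last by rewrite mul0r mulr0.
rewrite (inj_eq enum_rank_inj) (inj_eq xI) eq_sym (negPf qp) !mulr0 //.
Qed.

Lemma sqnorm_superposition x al : injective x ->
  sqnorm (superposition x al) = dot al al.
Proof.
move=> xI; apply: (@complexI R).
by rewrite sqnormE superposition_dot // mxE eqxx mulr1n.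
Qed.

Definition householder (ga al : I -> R) (p : I) : R :=
  al p - 2 / dot ga ga * dot ga al * ga p.

Lemma reflect_gate_superposition x ga al : injective x ->
  reflect_gate (superposition x ga) *m superposition x al =
  superposition x (householder ga al).
Proof.
move=> xI; rewrite mulmxBl mul1mx -scalemxAl -mulmxA superposition_dot //.
rewrite sqnorm_superposition // mul_mx_scalar scalerA -rmorphM /=.
rewrite /superposition scaler_sumr -sumrB; apply: eq_bigr => p _.
by rewrite scalerA -rmorphM -scalerBl -rmorphB.
Qed.

End Superposition.

Lemma superposition_ket (I : finType) (x : I -> B) (o : I) :
  superposition x (fun p => (p == o)%:R) = ket (x o).
Proof.
rewrite /superposition (bigD1 o) //= eqxx rmorph1 scale1r big1 ?addr0 // => p po.
by rewrite (negPf po) rmorph0 scale0r.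
Qed.

End Gates.

(** * Programs on superpositions: scaling, composition and complete measurement *)

Section Semantics.
Variables (R : realType) (n k : nat) (W : finType).
Local Notation B := (basis n k W).
Local Notation N := #|{: B}|.
Variable O : query n k -> answer n k.
Implicit Types (P : program R n k W) (psi : 'cV[R[i]]_N).

Lemma sqnormZ (r : R) psi : sqnorm (r%:C%C *: psi) = r ^+ 2 * sqnorm psi.
Proof.
rewrite /sqnorm mulr_sumr; apply: eq_bigr => i _; rewrite mxE.
by case: (psi i 0) => a b /=; ring.
Qed.

Lemma projectZ (r : R) m (f : B -> 'I_m) o psi :
  project f o (r%:C%C *: psi) = r%:C%C *: project f o psi.
Proof. by apply/colP => i; rewrite !mxE; case: ifP; rewrite ?mulr0. Qed.

Lemma sqnorm_ge0 psi : 0 <= sqnorm psi.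
Proof. by apply: sumr_ge0 => i _; rewrite addr_ge0 ?sqr_ge0. Qed.

(** States are not renormalised after a measurement, so what follows starts from a multiple of a
    ket. Homogeneity brings the analysis back to the ket itself. *)
Lemma prob_outputZ (r : R) P psi b :
  prob_output O P (r%:C%C *: psi) b = r ^+ 2 * prob_output O P psi b.
Proof.
elim: P psi => [c|U Uu P IH|P IH|m f P IH] psi /=.
- by rewrite sqnormZ; case: ifP; rewrite ?mulr0.
- by rewrite -scalemxAr IH.
- by rewrite -scalemxAr IH.
by rewrite mulr_sumr; apply: eq_bigr => o _; rewrite projectZ IH.
Qed.

Lemma nb_queriesZ (r : R) P psi :
  r != 0 -> nb_queries O P (r%:C%C *: psi) = nb_queries O P psi.
Proof.
move=> r0; elim: P psi => [c|U Uu P IH|P IH|m f P IH] psi //=.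
- by rewrite -scalemxAr IH.
- by rewrite -scalemxAr IH.
apply: eq_big => [o|o _]; last by rewrite projectZ IH.
rewrite projectZ scaler_eq0 negb_or -[0 : R[i]]/((0 : R)%:C)%C.
by rewrite (inj_eq (@complexI R)) r0.
Qed.

Lemma prob_output_ge0 P psi b : 0 <= prob_output O P psi b.
Proof.
elim: P psi => [c|U Uu P IH|P IH|m f P IH] psi //=.
  by case: ifP; rewrite ?sqnorm_ge0.
by apply: sumr_ge0 => o _; apply: IH.
Qed.

Lemma prob_output_le P psi b : prob_output O P psi b <= sqnorm psi.
Proof.
rewrite -(prob_output_total O P psi).
by case: b; rewrite ?lerDl ?lerDr prob_output_ge0.
Qed.

(** A [program] is a tree ending in outputs and cannot be concatenated, so a block of code is a map
    on continuations, and sequencing is composition of maps. *)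
Definition executes (F : program R n k W -> program R n k W) psi psi' (q : nat) :=
  forall P,
    (forall b, prob_output O (F P) psi b = prob_output O P psi' b) /\
    nb_queries O (F P) psi = (q + nb_queries O P psi')%N.

Lemma executes_comp F1 F2 psi psi1 psi2 q1 q2 :
  executes F1 psi psi1 q1 -> executes F2 psi1 psi2 q2 ->
  executes (F1 \o F2) psi psi2 (q1 + q2).
Proof.
move=> h1 h2 P; have [e1 t1] := h1 (F2 P); have [e2 t2] := h2 P.
by split=> [b|] /=; rewrite ?e1 ?t1 ?t2 ?addnA.
Qed.

Definition invol_gate (h : B -> B) (hK : involutive h) :
    program R n k W -> program R n k W :=
  Gate (perm_gate_unitary R (inv_inj hK)).

Definition phase (f : B -> bool) : program R n k W -> program R n k W :=
  Gate (phase_gate_unitary R f).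

Definition reflection (v : 'cV[R[i]]_N) : program R n k W -> program R n k W :=
  Gate (reflect_gate_unitary v).

Lemma prob_output_invol h (hK : involutive h) P c b :
  prob_output O (invol_gate hK P) (ket R c) b = prob_output O P (ket R (h c)) b.
Proof. by rewrite /= perm_gate_ket. Qed.

Lemma nb_queries_invol h (hK : involutive h) P c :
  nb_queries O (invol_gate hK P) (ket R c) = nb_queries O P (ket R (h c)).
Proof. by rewrite /= perm_gate_ket. Qed.

Section Executes.
Variables (I : finType) (x : I -> B).

Lemma executes_invol h (hK : involutive h) al :
  executes (invol_gate hK) (superposition x al) (superposition (h \o x) al) 0.
Proof. by move=> P; split=> [b|] /=; rewrite ?add0n perm_gate_superposition. Qed.

Lemma executes_query al :
  executes (@Query _ _ _ _) (superposition x al)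
    (superposition (oracle_step O \o x) al) 1.
Proof.
by move=> P; split=> [b|] /=; rewrite ?add1n -perm_gate_superposition.
Qed.

Lemma executes_phase f al :
  executes (phase f) (superposition x al)
    (superposition x (fun p => (-1) ^+ f (x p) * al p)) 0.
Proof. by move=> P; split=> [b|] /=; rewrite ?add0n phase_gate_superposition. Qed.

Lemma executes_reflection ga al : injective x ->
  executes (reflection (superposition x ga)) (superposition x al)
    (superposition x (householder ga al)) 0.
Proof.
by move=> xI P; split=> [b|] /=; rewrite ?add0n reflect_gate_superposition.
Qed.

Lemma eq_executes F y be be' psi q : x =1 y -> be =1 be' ->
  executes F psi (superposition x be) q -> executes F psi (superposition y be') q.
Proof. by move=> xy bb; rewrite (eq_superposition xy bb). Qed.

Lemma project_superposition al p : injective x ->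
  project (@enum_rank B) (enum_rank (x p)) (superposition x al) =
  (al p)%:C%C *: ket R (x p).
Proof.
move=> xI; apply/colP => i; rewrite !mxE enum_valK enum_val_eq.
case: eqP => [->|_]; last by rewrite mulr0.
rewrite summxE (bigD1 p) //= big1 ?addr0 => [|q qp]; rewrite !mxE enum_rankK.
  by rewrite eqxx.
by rewrite (inj_eq xI) eq_sym (negPf qp) mulr0.
Qed.

Lemma project_superposition0 (al : I -> R) o : (forall p, o != enum_rank (x p)) ->
  project (@enum_rank B) o (superposition x al) = 0.
Proof.
move=> ox; apply/colP => i; rewrite !mxE enum_valK.
case: eqP => // ->; rewrite summxE big1 // => p _.
by rewrite !mxE enum_val_eq (negPf (ox p)) mulr0.
Qed.

Lemma prob_output_measure al (f : 'I_N -> program R n k W) b : injective x ->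
  prob_output O (Measure (@enum_rank B) f) (superposition x al) b =
  \sum_p al p ^+ 2 * prob_output O (f (enum_rank (x p))) (ket R (x p)) b.
Proof.
move=> xI; pose r p := enum_rank (x p).
have rI : injective r by move=> p q /enum_rank_inj/xI.
rewrite /= (bigID (mem (r @: [set: I]))) /= [X in _ + X]big1 ?addr0 => [|o oN].
  rewrite big_imset => [|p q _ _ /rI //].
  by apply: eq_big => p; rewrite ?inE // project_superposition // prob_outputZ.
rewrite project_superposition0; last first.
  move=> p; apply: contraNneq oN => ->.
  by apply: imset_f; rewrite inE.
(* The null state is 0 times itself, so homogeneity gives it probability 0. *)
by rewrite -[0 in LHS](scale0r (0 : 'cV[R[i]]_N)) (prob_outputZ 0) expr0n mul0r.
Qed.

Lemma nb_queries_measure al (f : 'I_N -> program R n k W) T : injective x ->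
  (forall p, (nb_queries O (f (enum_rank (x p))) (ket R (x p)) <= T)%N) ->
  (nb_queries O (Measure (@enum_rank B) f) (superposition x al) <= T)%N.
Proof.
move=> xI fT /=; apply/bigmax_leqP => o o0.
case: (boolP [exists p, o == enum_rank (x p)]) => [/existsP[p /eqP oE]|].
  move: o0; rewrite {}oE project_superposition // scaler_eq0 negb_or => /andP[a0 _].
  rewrite nb_queriesZ //.
  by apply: contraNneq a0 => ->; rewrite rmorph0.
rewrite negb_exists => /forallP ox.
by rewrite project_superposition0 ?eqxx in o0.
Qed.

End Executes.

End Semantics.

(** * Grover search over adaptive classical protocols *)

Notation transcript n k := (answer n k * answer n k * answer n k * answer n k)%type.

(* The work register holds an index and the answers to four queries.  The last
   index [ord_max] is a dummy: it names no position of an adjacency list. *)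
Notation register n k := ('I_n.+1 * transcript n k)%type.

(** Four adaptive queries read a signed child: its name, the sign of the edge, its label, and the
    value of the variable named by the label. *)
Record protocol (n k : nat) := Protocol {
  ask0 : query n k;
  ask1 : answer n k -> query n k;
  ask2 : answer n k -> answer n k -> query n k;
  ask3 : answer n k -> answer n k -> answer n k -> query n k
}.

Section Protocol.
Variables (R : realType) (n k : nat).
Local Notation B := (basis n k (register n k)).
Local Notation prog := (program R n k (register n k)).
Variables (O : query n k -> answer n k) (pr : 'I_n.+1 -> protocol n k).

Definition ask (t : nat) (p : 'I_n.+1) (h : transcript n k) : query n k :=
  let: (a0, a1, a2, _) := h in
  match t with
  | 0 => ask0 (pr p)
  | 1 => ask1 (pr p) a0
  | 2 => ask2 (pr p) a0 a1
  | _ => ask3 (pr p) a0 a1 a2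
  end.

(** The query register rests at [QRoot]. A transposition turns it into the wanted query and back,
    which makes loading a permutation that undoes itself. *)
Definition load (t : nat) (b : B) : B :=
  let: (q, a, (p, h)) := b in (tperm QRoot (ask t p h) q, a, (p, h)).

Definition store (t : nat) (b : B) : B :=
  let: (q, a, (p, (a0, a1, a2, a3))) := b in
  match t with
  | 0 => (q, a0, (p, (a, a1, a2, a3)))
  | 1 => (q, a1, (p, (a0, a, a2, a3)))
  | 2 => (q, a2, (p, (a0, a1, a, a3)))
  | _ => (q, a3, (p, (a0, a1, a2, a)))
  end.

Definition negate (b : B) : B := let: (q, a, w) := b in (q, - a, w).

Lemma loadK t : involutive (load t).
Proof. by case=> [[q a] [p h]] /=; rewrite tpermK. Qed.

Lemma storeK t : involutive (store t).
Proof. by case=> [[q a] [p [[[a0 a1] a2] a3]]]; case: t => [|[|[|t]]]. Qed.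

Lemma negateK : involutive negate.
Proof. by case=> [[q a] w] /=; rewrite opprK. Qed.

Lemma negate_oracle_stepK (b : B) :
  negate (oracle_step O (negate (oracle_step O b))) = b.
Proof. by case: b => [[q a] w] /=; rewrite opprD opprK addrK. Qed.

Definition forward (t : nat) : prog -> prog :=
  invol_gate (loadK t) \o (@Query _ _ _ _ \o
    (invol_gate (loadK t) \o invol_gate (storeK t))).

(* Negating the answer register around a query subtracts the answer. *)
Definition backward (t : nat) : prog -> prog :=
  invol_gate (storeK t) \o (invol_gate (loadK t) \o
    (invol_gate negateK \o (@Query _ _ _ _ \o
      (invol_gate negateK \o invol_gate (loadK t))))).

Definition fstep t : B -> B := store t \o (load t \o (oracle_step O \o load t)).

Lemma executes_forward t (x : 'I_n.+1 -> B) al :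
  executes O (forward t) (superposition x al) (superposition (fstep t \o x) al) 1.
Proof.
rewrite -[1%N]/(0 + (1 + (0 + 0)))%N.
apply: executes_comp; first exact: executes_invol.
apply: executes_comp; first exact: executes_query.
by apply: executes_comp; exact: executes_invol.
Qed.

Lemma executes_backward t (x : 'I_n.+1 -> B) al :
  executes O (backward t) (superposition (fstep t \o x) al) (superposition x al) 1.
Proof.
rewrite -[1%N]/(0 + (0 + (0 + (1 + (0 + 0)))))%N.
have e : load t \o (negate \o (oracle_step O \o (negate \o (load t \o
    (store t \o (fstep t \o x)))))) =1 x.
  move=> p /=; rewrite storeK loadK.
  by rewrite negate_oracle_stepK loadK.
apply: executes_comp; first exact: executes_invol.
apply: executes_comp; first exact: executes_invol.
apply: executes_comp; first exact: executes_invol.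
apply: executes_comp; first exact: executes_query.
apply: executes_comp; first exact: executes_invol.
by apply: (eq_executes e (fun=> erefl)); apply: executes_invol.
Qed.

Definition compute : prog -> prog :=
  forward 0 \o (forward 1 \o (forward 2 \o forward 3)).

Definition uncompute : prog -> prog :=
  backward 3 \o (backward 2 \o (backward 1 \o backward 0)).

Definition start (p : 'I_n.+1) : B := (QRoot, 0, (p, (0, 0, 0, 0))).

Definition answers (p : 'I_n.+1) : transcript n k :=
  let a0 := O (ask0 (pr p)) in
  let a1 := O (ask1 (pr p) a0) in
  let a2 := O (ask2 (pr p) a0 a1) in
  (a0, a1, a2, O (ask3 (pr p) a0 a1 a2)).

Definition finish (p : 'I_n.+1) : B := (QRoot, 0, (p, answers p)).

Lemma start_inj : injective start. Proof. by move=> p q []. Qed.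
Lemma finish_inj : injective finish. Proof. by move=> p q []. Qed.

(** Each transcript slot holds 0 when its answer is swapped in, so the answer register is back at 0,
    and the query register at [QRoot], before the next query. *)
Lemma fstep_start :
  fstep 3 \o (fstep 2 \o (fstep 1 \o (fstep 0 \o start))) =1 finish.
Proof. by move=> p; rewrite /fstep /= !(tpermL, add0r, tpermR). Qed.

Lemma executes_compute al :
  executes O compute (superposition start al) (superposition finish al) 4.
Proof.
apply: (eq_executes fstep_start (fun=> erefl)).
rewrite -[4%N]/(1 + (1 + (1 + 1)))%N.
by do 3!(apply: executes_comp; first exact: executes_forward);
  apply: executes_forward.
Qed.

Lemma executes_uncompute al :
  executes O uncompute (superposition finish al) (superposition start al) 4.
Proof.
rewrite -(eq_superposition fstep_start (fun=> erefl)).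
rewrite -[4%N]/(1 + (1 + (1 + 1)))%N.
by do 3!(apply: executes_comp; first exact: executes_backward);
  apply: executes_backward.
Qed.

Variable g : 'I_n.+1 -> transcript n k -> bool.

Definition marked (p : 'I_n.+1) : bool := g p (answers p).

(** The transcript is erased before the reflection, since amplitudes of distinct indices only
    interfere on [start] states. The reflection negates [al] instead of fixing it, so this is the
    usual Grover iteration up to a global sign, whence the factors [(-1) ^+ K] in [amplitudeE]. *)
Definition grover_step (al : 'I_n.+1 -> R) : prog -> prog :=
  compute \o (phase (fun b : B => g b.2.1 b.2.2) \o
    (uncompute \o reflection (superposition start al))).

Definition grover_map (al de : 'I_n.+1 -> R) : 'I_n.+1 -> R :=
  householder al (fun p => (-1) ^+ marked p * de p).

Lemma executes_grover_step al de :
  executes O (grover_step al) (superposition start de)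
    (superposition start (grover_map al de)) 8.
Proof.
rewrite -[8%N]/(4 + (0 + (4 + 0)))%N.
apply: executes_comp; first exact: executes_compute.
apply: executes_comp; first exact: executes_phase.
apply: executes_comp; first exact: executes_uncompute.
exact: (executes_reflection _ _ _ start_inj).
Qed.

Definition amplitude (al : 'I_n.+1 -> R) (K : nat) : 'I_n.+1 -> R :=
  iter K (grover_map al) al.

Lemma executes_grover K al de :
  executes O (iter K (comp (grover_step al)) id) (superposition start de)
    (superposition start (iter K (grover_map al) de)) (8 * K).
Proof.
elim: K de => [|K IH] de; first by move=> P; rewrite muln0.
rewrite iterS iterSr mulnS; apply: executes_comp; last exact: IH.
exact: executes_grover_step.
Qed.

Definition home : B := start ord_max.

Definition tperm_home (b : B) : B -> B := tperm b home.

Lemma tperm_homeK b : involutive (tperm_home b).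
Proof. exact: tpermK. Qed.

Lemma tperm_homeL b : tperm_home b b = home.
Proof. exact: tpermL. Qed.

Definition prepare (al : 'I_n.+1 -> R) : prog -> prog :=
  reflection (superposition start (fun p => al p - (p == ord_max)%:R)).

Lemma dot_delta (de : 'I_n.+1 -> R) (o : 'I_n.+1) :
  dot de (fun p => (p == o)%:R) = de o.
Proof.
rewrite /dot (bigD1 o) //= eqxx mulr1 big1 ?addr0 // => p po.
by rewrite (negPf po) mulr0.
Qed.

(** The reflection along the difference of two real unit vectors exchanges them; here the vectors
    are [al] and the delta at the dummy index. *)
Lemma executes_prepare al : dot al al = 1 ->
  executes O (prepare al) (ket R home) (superposition start al) 0.
Proof.
move=> al1; rewrite -(superposition_ket R start ord_max).
set ga := fun p => al p - (p == ord_max)%:R.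
have e : householder ga (fun p => (p == ord_max)%:R) =1 al; last first.
  by apply: (eq_executes (fun=> erefl) e); apply: executes_reflection start_inj.
have gg : dot ga ga = 2 - 2 * al ord_max.
  transitivity (dot al al - 2 * dot al (fun p => (p == ord_max)%:R) +
      dot (fun p : 'I_n.+1 => (p == ord_max)%:R) (fun p => (p == ord_max)%:R)).
    rewrite /dot mulr_sumr -sumrB -big_split /=; apply: eq_bigr => p _.
    rewrite /ga; ring.
  by rewrite al1 !dot_delta eqxx /=; ring.
have go : ga ord_max = al ord_max - 1 by rewrite /ga eqxx.
move=> p; rewrite /householder dot_delta gg go.
(* If this coefficient is 1, then [ga] has norm 0 and [al] is already the delta; otherwise the
   denominator [2 - 2 * al ord_max] is nonzero. *)
case: (eqVneq (al ord_max) 1) => [a1|a1].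
  rewrite a1 subrr mulr0 mul0r subr0.
  have /psumr_eq0P g0 : dot ga ga = 0 by rewrite gg a1 mulr1 subrr.
  have /eqP : ga p * ga p = 0 by apply: g0 => // q _; rewrite -expr2 sqr_ge0.
  by rewrite mulf_eq0 orbb subr_eq0 => /eqP.
rewrite /ga; field; rewrite -[X in X - _]mulr1 -mulrBr mulf_neq0 ?pnatr_eq0 //.
by rewrite subr_eq0 eq_sym.
Qed.

(* The final measurement reads off the index and the transcript, and the state
   is brought back to [home] before going on. *)
Definition run (al : 'I_n.+1 -> R) (K : nat)
    (cont : 'I_n.+1 -> transcript n k -> prog) : prog :=
  (prepare al \o (iter K (comp (grover_step al)) id \o compute))
    (Measure (@enum_rank B) (fun o =>
      invol_gate (tperm_homeK (enum_val o))
        (cont (enum_val o).2.1 (enum_val o).2.2))).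

Lemma executes_run al K : dot al al = 1 ->
  executes O (prepare al \o (iter K (comp (grover_step al)) id \o compute))
    (ket R home) (superposition finish (amplitude al K)) (8 * K + 4).
Proof.
move=> al1; rewrite -[X in executes _ _ _ _ X]add0n.
apply: executes_comp; first exact: executes_prepare.
by apply: executes_comp; [apply: executes_grover | apply: executes_compute].
Qed.

Lemma prob_output_run al K cont b : dot al al = 1 ->
  prob_output O (run al K cont) (ket R home) b =
  \sum_p amplitude al K p ^+ 2 * prob_output O (cont p (answers p)) (ket R home) b.
Proof.
move=> al1; rewrite (executes_run K al1 _).1.
rewrite prob_output_measure; last exact: finish_inj.
apply: eq_bigr => p _; rewrite prob_output_invol enum_rankK tperm_homeL.
by [].
Qed.

Lemma nb_queries_run al K cont T : dot al al = 1 ->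
  (forall p, (nb_queries O (cont p (answers p)) (ket R home) <= T)%N) ->
  (nb_queries O (run al K cont) (ket R home) <= 8 * K + 4 + T)%N.
Proof.
move=> al1 contT; rewrite (executes_run K al1 _).2 leq_add2l.
apply: nb_queries_measure; first exact: finish_inj.
by move=> p; rewrite nb_queries_invol enum_rankK tperm_homeL.
Qed.

End Protocol.

(** * Trigonometry of Grover rotations *)

Section Trigonometry.
Variable R : realType.
Implicit Types (x th : R) (K M t d : nat).

Lemma sin_le_id x : 0 <= x -> sin x <= x.
Proof.
move=> x0; have [|c _] := @MVT_segment R sin cos 0 x x0.
  by apply: continuous_subspaceT; exact: continuous_sin.
rewrite sin0 !subr0 => ->.
by rewrite -[leRHS]mul1r ler_wpM2r ?cos_le1.
Qed.

(** If the initial state is at angle [th] from the unmarked subspace, this is its angle after [K]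
    Grover iterations. *)
Definition odd_angle K th : R := K.*2.+1%:R * th.

Lemma odd_angleS K th : odd_angle K.+1 th = odd_angle K th + th *+ 2.
Proof. by rewrite /odd_angle doubleS -[K.*2.+3]addn2 natrD; ring. Qed.

Lemma sin_odd_angleS K th : sin (odd_angle K.+1 th) =
  sin (odd_angle K th) * (1 - 2 * sin th ^+ 2) +
  cos (odd_angle K th) * (2 * sin th * cos th).
Proof.
rewrite odd_angleS sinD cos_mulr2n sin_mulr2n cos2sin2; ring.
Qed.

Lemma cos_odd_angleS K th : cos (odd_angle K.+1 th) =
  cos (odd_angle K th) * (1 - 2 * sin th ^+ 2) -
  sin (odd_angle K th) * (2 * sin th * cos th).
Proof.
rewrite odd_angleS cosD cos_mulr2n sin_mulr2n cos2sin2; ring.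
Qed.

(** Since 2 cos(u)^2 = 1 + cos(2u), this is a sum of cosines in arithmetic progression; multiplying
    by sin(2 th) makes it telescope. *)
Lemma sum_cos2_odd_angle M th :
  \sum_(K < M) cos (odd_angle K th) ^+ 2 * (4 * sin (th *+ 2)) =
  M%:R * 2 * sin (th *+ 2) + sin (M%:R * 4 * th).
Proof.
elim: M => [|M IH]; first by rewrite big_ord0 !mul0r sin0 addr0.
rewrite big_ord_recr /= IH.
have -> : M.+1%:R * 4 * th = odd_angle M th *+ 2 + th *+ 2.
  by rewrite /odd_angle -[M.+1]addn1 -muln2 -addn1 !(natrD, natrM); ring.
have -> : M%:R * 4 * th = odd_angle M th *+ 2 - th *+ 2.
  by rewrite /odd_angle -muln2 -addn1 !(natrD, natrM); ring.
rewrite sinB (sinD (odd_angle M th *+ 2)) (cos_mulr2n (odd_angle M th)).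
by rewrite -[M.+1]addn1 natrD; ring.
Qed.

(** The mean is 1/2 + sin(4 M th) / (4 M sin(2 th)), and the hypothesis bounds the second term by
    1/4. *)
Lemma mean_cos2_odd_angle M th : 1 <= M%:R * sin (th *+ 2) ->
  \sum_(K < M) cos (odd_angle K th) ^+ 2 <= 3 / 4 * M%:R.
Proof.
move=> hM; have M0 : 0 < M%:R :> R.
  by rewrite ltr0n lt0n; apply: contraTneq hM => ->; rewrite mul0r ler10.
have s0 : 0 < sin (th *+ 2).
  by rewrite -(pmulr_rgt0 _ M0) (lt_le_trans ltr01).
rewrite -(@ler_pM2r _ (4 * sin (th *+ 2))) ?mulr_gt0 // mulr_suml.
rewrite sum_cos2_odd_angle.
have := sin_le1 (M%:R * 4 * th); nra.
Qed.

Definition tuned_angle K : R := pi / 2 / K.*2.+1%:R.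

Lemma sin_tuned_angle K : sin (odd_angle K (tuned_angle K)) = 1.
Proof. by rewrite /odd_angle /tuned_angle mulrC divfK ?pnatr_eq0 ?sin_pihalf. Qed.

(** By sin a <= a and pi / 2 < 2. This is what keeps the damped weight [exact_weight] at most 1. *)
Lemma sin2_tuned_angle_le K : (0 < K)%N -> sin (tuned_angle K) ^+ 2 <= K%:R ^- 2.
Proof.
move=> K0; have K0' : 0 < K%:R :> R by rewrite ltr0n.
have pi2 := pihalf_lt2 R; have pi0 := pihalf_ge1 R.
have a0 : 0 <= tuned_angle K by rewrite divr_ge0 ?ler0n //; lra.
have aK : tuned_angle K <= K%:R^-1.
  rewrite /tuned_angle ler_pdivrMr ?ltr0n // [leRHS]mulrC ler_pdivlMr //.
  have -> : K.*2.+1%:R = 2 * K%:R + 1 :> R by rewrite -addn1 natrD -muln2 natrM mulrC.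
  nra.
have s0 : 0 <= sin (tuned_angle K).
  rewrite sin_ge0_pi // a0 (le_trans aK) //.
  by rewrite (le_trans _ (pi_ge2 R)) // (@le_trans _ _ 1) ?invf_le1 ?ler1n // ler1n.
rewrite -exprVn ler_sqr ?nnegrE ?invr_ge0 ?ler0n //.
exact: le_trans (sin_le_id a0) aK.
Qed.

End Trigonometry.

(** * The number of Grover iterations *)

Section Iterations.
Variable R : realType.

(** The successor makes the number positive and larger than sqrt(d / t), at the cost of a factor 2
    when [t <= d]. *)
Definition nb_iterations (d t : nat) : nat :=
  (Num.truncn (Num.sqrt (d%:R / t%:R : R))).+1.

Lemma nb_iterations_ge d t : (0 < t)%N ->
  d%:R / t%:R <= (nb_iterations d t)%:R ^+ 2 :> R.
Proof.
move=> t0; rewrite -[leLHS]sqr_sqrtr ?divr_ge0 ?ler0n //.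
rewrite ler_sqr ?nnegrE ?sqrtr_ge0 ?ler0n // ltW //.
by rewrite /nb_iterations Num.Theory.truncnS_gt.
Qed.

Lemma nb_iterations_le d t : (0 < t <= d)%N ->
  (nb_iterations d t)%:R <= 2 * Num.sqrt (d%:R / t%:R) :> R.
Proof.
move=> /andP[t0 td]; rewrite /nb_iterations; set s := Num.sqrt _.
have s1 : 1 <= s.
  rewrite -[leLHS]sqrtr1 ler_sqrt ?divr_ge0 ?ler0n //.
  by rewrite ler_pdivlMr ?mul1r ?ler_nat ?ltr0n.
have : (Num.truncn s)%:R <= s by rewrite Num.Theory.truncn_le sqrtr_ge0.
rewrite -addn1 natrD; lra.
Qed.

(** A random number of iterations is drawn from the index register, so it has to fit there. The
    bound fails for [d = t = 1], where the number is 2. *)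
Lemma nb_iterations_le_id d t : (0 < t)%N -> (1 < d)%N ->
  (nb_iterations d t <= d)%N.
Proof.
move=> t0 d1; rewrite /nb_iterations.
have d0 : 0 < d%:R :> R by rewrite ltr0n ltnW.
rewrite Num.Theory.truncn_lt_nat ?sqrtr_ge0 //.
rewrite -[ltRHS]ger0_norm ?ler0n // -sqrtr_sqr ltr_sqrt ?exprn_gt0 //.
rewrite (@le_lt_trans _ _ d%:R) //.
  by rewrite ler_pdivrMr ?ltr0n // ler_peMr ?ler1n ?ltW.
by rewrite expr2 ltr_pMr // ltr1n.
Qed.

End Iterations.

(** * Search attempts *)

Section Attempts.
Variables (R : realType) (n k : nat).
Local Notation prog := (program R n k (register n k)).
Variables (O : query n k -> answer n k) (pr : 'I_n.+1 -> protocol n k).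
Variable g : 'I_n.+1 -> transcript n k -> bool.
Local Notation home := (ket R (home n k)).
Local Notation marked := (marked O pr g).
Local Notation amplitude := (amplitude O pr g).
Local Notation prob P b := (prob_output O P home b).
Local Notation time P := (nb_queries O P home).
Implicit Types (al : 'I_n.+1 -> R) (yes no : prog).

Definition miss al (K : nat) : R := \sum_(p | ~~ marked p) amplitude al K p ^+ 2.

Lemma dotxx (I : finType) (al : I -> R) : dot al al = \sum_p al p ^+ 2.
Proof. by apply: eq_bigr => p _; rewrite expr2. Qed.

Lemma sum_unmarked al th : dot al al = 1 ->
  \sum_(p | marked p) al p ^+ 2 = sin th ^+ 2 ->
  \sum_(p | ~~ marked p) al p ^+ 2 = cos th ^+ 2.
Proof.
move=> al1 hs; rewrite cos2sin2 -hs -al1 dotxx (bigID marked predT) /=.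
by rewrite addrAC subrr add0r.
Qed.

(** The iterations stay in the plane spanned by the marked and the unmarked part of [al], where each
    step rotates by [2 * th] up to sign. The factors [a] and [b] are given through products so that
    [sin th = 0] and [cos th = 0] need no special treatment. *)
Lemma amplitudeE al K th : dot al al = 1 ->
  \sum_(p | marked p) al p ^+ 2 = sin th ^+ 2 ->
  exists a b, [/\ a * sin th = (-1) ^+ K * sin (odd_angle K th),
    b * cos th = (-1) ^+ K * cos (odd_angle K th)
    & forall p, amplitude al K p = (if marked p then a else b) * al p].
Proof.
move=> al1 hs.
have hc := sum_unmarked al1 hs.
elim: K => [|K [a [b [ha hb hab]]]].
  exists 1, 1; rewrite /odd_angle !mul1r.
  by split=> // p; case: ifP; rewrite mul1r.
pose s := dot al (fun p => (-1) ^+ marked p * amplitude al K p).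
have sE : s = b * cos th ^+ 2 - a * sin th ^+ 2.
  rewrite /s /dot (bigID marked) /= -hs -hc !mulr_sumr addrC -sumrN.
  congr (_ + _); apply: eq_bigr => p mp; rewrite hab.
    by rewrite (negPf mp) expr0; ring.
  by rewrite mp expr1; ring.
(* The phase negates the marked amplitudes, then the reflection subtracts [2 * s * al], with [s] the
   overlap of the phased state with [al]. *)
exists (- a - 2 * s), (b - 2 * s); split.
- transitivity (- (a * sin th) * (1 - 2 * sin th ^+ 2) -
      (b * cos th) * (2 * sin th * cos th)); first by rewrite sE; ring.
  by rewrite ha hb sin_odd_angleS (exprS (-1)); ring.
- transitivity ((b * cos th) * (1 - 2 * cos th ^+ 2) +
      (a * sin th) * (2 * sin th * cos th)); first by rewrite sE; ring.
  by rewrite ha hb cos_odd_angleS (exprS (-1)) cos2sin2; ring.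
move=> p.
have -> : amplitude al K.+1 p = (-1) ^+ marked p * amplitude al K p - 2 * s * al p.
  by rewrite /s /amplitude iterS /grover_map /householder al1 divr1.
by rewrite hab; case: (marked p); rewrite ?expr1 ?expr0; ring.
Qed.

Lemma sum_amplitude_marked al K th : dot al al = 1 ->
  \sum_(p | marked p) al p ^+ 2 = sin th ^+ 2 ->
  \sum_(p | marked p) amplitude al K p ^+ 2 = sin (odd_angle K th) ^+ 2.
Proof.
move=> al1 hs; have [a [b [ha _ hab]]] := amplitudeE K al1 hs.
transitivity ((a * sin th) ^+ 2); last by rewrite ha exprMn sqrr_sign mul1r.
rewrite exprMn -hs mulr_sumr; apply: eq_bigr => p mp.
by rewrite hab mp exprMn.
Qed.

Lemma miss_cos al K th : dot al al = 1 ->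
  \sum_(p | marked p) al p ^+ 2 = sin th ^+ 2 ->
  miss al K = cos (odd_angle K th) ^+ 2.
Proof.
move=> al1 hs; have [a [b [_ hb hab]]] := amplitudeE K al1 hs.
transitivity ((b * cos th) ^+ 2); last by rewrite hb exprMn sqrr_sign mul1r.
rewrite exprMn -(sum_unmarked al1 hs) mulr_sumr; apply: eq_bigr => p mp.
by rewrite hab (negPf mp) exprMn.
Qed.

Lemma marked_angle al : dot al al = 1 ->
  exists2 th, \sum_(p | marked p) al p ^+ 2 = sin th ^+ 2 & 0 <= sin th /\ 0 <= cos th.
Proof.
move=> al1; pose S := \sum_(p | marked p) al p ^+ 2.
have S0 : 0 <= S by apply: sumr_ge0 => p _; apply: sqr_ge0.
have S1 : S <= 1.
  rewrite -al1 dotxx (bigID marked predT) /= lerDl.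
  by apply: sumr_ge0 => p _; rewrite sqr_ge0.
have r1 : -1 <= Num.sqrt S <= 1.
  rewrite (le_trans _ (sqrtr_ge0 S)) ?lerN10 //=.
  by rewrite -[leRHS]sqrtr1 ler_wsqrtr.
exists (asin (Num.sqrt S)); first by rewrite asinK // sqr_sqrtr.
by rewrite asinK // cos_asin // !sqrtr_ge0.
Qed.

Lemma sum_amplitude al K : dot al al = 1 -> \sum_p amplitude al K p ^+ 2 = 1.
Proof.
move=> al1; have [th hs _] := marked_angle al1.
rewrite (bigID marked) /= (sum_amplitude_marked _ al1 hs).
by rewrite -/(miss al K) (miss_cos _ al1 hs) addrC cos2Dsin2.
Qed.

Lemma miss_itv al K : dot al al = 1 -> 0 <= miss al K <= 1.
Proof.
move=> al1; have [th hs _] := marked_angle al1.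
by rewrite (miss_cos _ al1 hs) sqr_ge0 -[leRHS](cos2Dsin2 (odd_angle K th)) lerDl sqr_ge0.
Qed.

Lemma miss_unmarked al K : dot al al = 1 -> (forall p, ~~ marked p) ->
  miss al K = 1.
Proof.
by move=> al1 m0; rewrite -(sum_amplitude K al1); apply: eq_bigl => p; rewrite m0.
Qed.

Definition attempt al (K : nat) yes no : prog :=
  run pr g al K (fun p h => if g p h then yes else no).

(** Seen from its continuations, an attempt is a coin that misses with probability [f]: the
    measurement returns the register to [home], so no quantum state crosses over. *)
Definition branches (A : prog -> prog -> prog) (f : R) (q : nat) :=
  forall yes no,
    (forall b, prob (A yes no) b = (1 - f) * prob yes b + f * prob no b) /\
    (forall T, (time yes <= T)%N -> (time no <= T)%N ->
      (time (A yes no) <= q + T)%N).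

Lemma branches_attempt al K : dot al al = 1 ->
  branches (attempt al K) (miss al K) (8 * K + 4).
Proof.
move=> al1 yes no; split=> [b|T yT nT]; last first.
  by apply: nb_queries_run => // p; case: ifP.
rewrite prob_output_run // -(sum_amplitude K al1) !(bigID marked predT) /=.
rewrite -/(miss al K) addrK !mulr_suml.
congr (_ + _); apply: eq_bigr => p; rewrite /marked; first by move=> ->.
by move/negPf=> ->.
Qed.

(** The second attempt starts afresh once the first has missed, so the miss probabilities
    multiply. *)
Lemma branches_seq A A' f f' q q' : branches A f q -> branches A' f' q' ->
  branches (fun yes no => A yes (A' yes no)) (f * f') (q + q').
Proof.
move=> hA hA' yes no; have [e' t'] := hA' yes no.
have [e t] := hA yes (A' yes no); split=> [b|T yT nT].
  by rewrite e e'; ring.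
rewrite -addnA; apply: t; last exact: t'.
by rewrite (leq_trans yT) // leq_addl.
Qed.

Lemma branches_no : branches (fun _ no => no) 1 0.
Proof. by move=> yes no; split=> [b|T _ //]; rewrite subrr mul0r add0r mul1r. Qed.

End Attempts.

Lemma card_ord_lt m d : (d <= m)%N -> #|[pred i : 'I_m | (i < d)%N]| = d.
Proof.
move=> dm; rewrite -[RHS]card_ord -[RHS]sum1_card.
by rewrite (big_ord_widen m (fun=> 1%N)) // sum1_card.
Qed.

(** * Exact attempts and attempts with a random number of iterations *)

Section Search.
Variables (R : realType) (n k : nat).
Local Notation prog := (program R n k (register n k)).
Variables (O : query n k -> answer n k) (pr : 'I_n.+1 -> protocol n k).
Variable g : 'I_n.+1 -> transcript n k -> bool.
Local Notation marked := (marked O pr g).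
Local Notation miss := (miss O pr g).
Local Notation branches := (@branches R n k O).
Local Notation attempt := (attempt pr g).
Local Notation nb_iterations := (nb_iterations R).
Implicit Types (yes no : prog) (d t : nat).

(* The uniform superposition of [d] indices, scaled down so that its weight is
   [ga]; the dummy index carries the rest. *)
Definition damped d (ga : R) (p : 'I_n.+1) : R :=
  if p == ord_max then Num.sqrt (1 - ga)
  else if (p < d)%N then Num.sqrt (ga / d%:R) else 0.

Lemma sum_damped d ga (F : nat -> R) : (d <= n)%N -> 0 <= ga <= 1 ->
  \sum_p damped d ga p ^+ 2 * F p =
  ga / d%:R * (\sum_(i < d) F i) + (1 - ga) * F n.
Proof.
move=> dn /andP[g0 g1]; rewrite big_ord_recr /=; congr (_ + _); last first.
  by rewrite /damped eqxx sqr_sqrtr ?subr_ge0.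
rewrite (big_ord_widen n F) // mulr_sumr [RHS]big_mkcond /=.
apply: eq_bigr => i _; rewrite /damped /= -(inj_eq val_inj) /=.
rewrite (ltn_eqF (ltn_ord i)).
by case: ifP => _; rewrite ?expr0n ?mul0r // sqr_sqrtr // divr_ge0 ?ler0n.
Qed.

Lemma dot_damped d ga : (0 < d <= n)%N -> 0 <= ga <= 1 ->
  dot (damped d ga) (damped d ga) = 1.
Proof.
move=> /andP[d0 dn] g01; have := sum_damped (fun=> 1) dn g01.
rewrite sumr_const card_ord divfK ?pnatr_eq0 -?lt0n // mulr1 addrC subrK => <-.
by apply: eq_bigr => p _; rewrite mulr1 expr2.
Qed.

Lemma sum_marked_damped d ga : (d <= n)%N -> 0 <= ga ->
  (forall p, marked p -> (p < d)%N) ->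
  \sum_(p | marked p) damped d ga p ^+ 2 = #|[pred p | marked p]|%:R * (ga / d%:R).
Proof.
move=> dn g0 md; rewrite mulr_natl -sumr_const; apply: eq_bigr => p /md pd.
rewrite /damped pd -(inj_eq val_inj) /= (ltn_eqF (leq_trans pd dn)).
by rewrite sqr_sqrtr // divr_ge0 ?ler0n.
Qed.

Lemma card_marked_le d : (d <= n)%N -> (forall p, marked p -> (p < d)%N) ->
  (#|[pred p | marked p]| <= d)%N.
Proof.
move=> dn md; rewrite -[leqRHS](card_ord_lt (leqW dn)).
by apply: subset_leq_card; apply/subsetP => p; rewrite !inE => /md.
Qed.

(** Chosen so that [t] marked indices, each of squared amplitude [exact_weight d t / d], have total
    weight the squared sine of the tuned angle. *)
Definition exact_weight d t : R :=
  sin (tuned_angle R (nb_iterations d t)) ^+ 2 * (d%:R / t%:R).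

Definition exact_attempt d t : prog -> prog -> prog :=
  attempt (damped d (exact_weight d t)) (nb_iterations d t).

Definition exact_miss d t : R :=
  miss (damped d (exact_weight d t)) (nb_iterations d t).

Lemma exact_weight_itv d t : (0 < t)%N -> 0 <= exact_weight d t <= 1.
Proof.
move=> t0; rewrite /exact_weight mulr_ge0 ?sqr_ge0 ?divr_ge0 ?ler0n //=.
have K0 : (0 < nb_iterations d t)%N by [].
rewrite (le_trans (ler_wpM2r _ (sin2_tuned_angle_le R K0))) ?divr_ge0 ?ler0n //.
by rewrite mulrC ler_pdivrMr ?exprn_gt0 ?ltr0n // mul1r nb_iterations_ge.
Qed.

Lemma exact_attemptP d t : (0 < t)%N -> (0 < d <= n)%N ->
  [/\ branches (exact_attempt d t) (exact_miss d t) (8 * nb_iterations d t + 4),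
      0 <= exact_miss d t <= 1
    & (forall p, ~~ marked p) -> exact_miss d t = 1].
Proof.
move=> t0 dn; have al1 := dot_damped dn (exact_weight_itv d t0).
split; [exact: branches_attempt | exact: miss_itv | exact: miss_unmarked].
Qed.

Lemma exact_miss0 d t : (0 < t)%N -> (0 < d <= n)%N ->
  (forall p, marked p -> (p < d)%N) -> #|[pred p | marked p]| = t ->
  exact_miss d t = 0.
Proof.
move=> t0 /[dup] /andP[d0 dn] d0n md tE.
have al1 := dot_damped d0n (exact_weight_itv d t0).
have [w0 _] := andP (exact_weight_itv d t0).
rewrite /exact_miss (miss_cos _ al1 (th := tuned_angle R (nb_iterations d t))).
  by rewrite cos2sin2 sin_tuned_angle expr1n subrr.
rewrite sum_marked_damped // tE /exact_weight; field.
by rewrite !pnatr_eq0 -!lt0n t0 d0.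
Qed.

(* An attempt with a random number of iterations, drawn by measuring a uniform
   superposition; [minn] only matters for indices of zero amplitude. *)
Definition random_attempt d t yes no : prog :=
  let M := nb_iterations d t in
  run pr g (damped M 1) 0 (fun p _ =>
    attempt (damped d (1 / 2)) (minn p M.-1) yes no).

Definition random_miss d t : R :=
  let M := nb_iterations d t in
  M%:R^-1 * \sum_(K < M) miss (damped d (1 / 2)) K.

Lemma half_itv : 0 <= (1 / 2 : R) <= 1. Proof. by apply/andP; split; lra. Qed.

Lemma sum_nb_iterations d t (F : nat -> R) : (0 < t)%N -> (1 < d <= n)%N ->
  \sum_p damped (nb_iterations d t) 1 p ^+ 2 * F (minn p (nb_iterations d t).-1) =
  (nb_iterations d t)%:R^-1 * \sum_(K < nb_iterations d t) F K.
Proof.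
move=> t0 /andP[d1 dn]; set M := nb_iterations d t.
have Mn : (M <= n)%N := leq_trans (nb_iterations_le_id R t0 d1) dn.
rewrite (sum_damped (fun p => F (minn p M.-1)) Mn) ?lexx ?ler01 //.
rewrite subrr mul0r addr0 mul1r; congr (_ * _); apply: eq_bigr => i _.
by rewrite (minn_idPl _) // -ltnS prednK // ltn_ord.
Qed.

Lemma random_attemptP d t : (0 < t)%N -> (1 < d <= n)%N ->
  [/\ branches (random_attempt d t) (random_miss d t) (8 * nb_iterations d t),
      0 <= random_miss d t <= 1
    & (forall p, ~~ marked p) -> random_miss d t = 1].
Proof.
move=> t0 d1n; have /andP[d1 dn] := d1n; set M := nb_iterations d t.
have M0 : (0 < M)%N by [].
have M0R : 0 < M%:R :> R by rewrite ltr0n.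
have Mn : (0 < M <= n)%N by rewrite (leq_trans (nb_iterations_le_id R t0 d1) dn).
have b1 : dot (damped M 1) (damped M 1) = 1.
  by apply: dot_damped; rewrite ?lexx ?ler01.
have al1 : dot (damped d (1 / 2)) (damped d (1 / 2)) = 1.
  by apply: dot_damped; rewrite ?half_itv // (ltnW d1).
have sM (c : R) : M%:R^-1 * (\sum_(K < M) c) = c.
  by rewrite sumr_const card_ord -[c *+ M]mulr_natr mulrC mulfK ?gt_eqF.
split.
- move=> yes no; split=> [b|T yT nT].
    rewrite /random_attempt prob_output_run //.
    under eq_bigr => p _.
      rewrite (branches_attempt O pr g _ al1 yes no).1.
      over.
    rewrite /= (sum_nb_iterations (fun K => (1 - miss (damped d (1 / 2)) K) *
      prob_output O yes (ket R (home n k)) b + miss (damped d (1 / 2)) K *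
      prob_output O no (ket R (home n k)) b) t0 d1n).
    rewrite big_split /= -!mulr_suml sumrB mulrDr !mulrA mulrBr -/M sM.
    by rewrite /random_miss.
  (* Drawing the number of iterations costs 4 queries and the attempt at most 8 (M - 1) + 4, which
     makes 8 M. *)
  rewrite -[M]prednK // mulnS -[8%N]/(4 + 4)%N -addnA -addnA.
  apply: (nb_queries_run g 0 (T := (4 + 8 * M.-1 + T)%N)) => // p.
  have h := (branches_attempt O pr g (minn p M.-1) al1 yes no).2 T yT nT.
  apply: leq_trans h _; rewrite leq_add2r addnC leq_add2l leq_mul2l.
  by rewrite geq_minr.
- rewrite /random_miss -/M mulr_ge0 ?invr_ge0 ?ler0n ?sumr_ge0 //=.
    rewrite -[leRHS](sM 1) ler_wpM2l ?invr_ge0 ?ler0n // ler_sum // => K _.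
    by have /andP[] := miss_itv O pr g K al1.
  by move=> K _; have /andP[] := miss_itv O pr g K al1.
move=> m0; rewrite /random_miss -/M -[RHS](sM 1); congr (_ * _).
by apply: eq_bigr => K _; rewrite miss_unmarked.
Qed.

(** Put x = m / d <= 1, with m the number of marked indices. The weight 1/2 gives sin(th)^2 = x / 2,
    hence sin(2 th)^2 = x (2 - x) >= x, and M^2 >= d / t gives M^2 x >= m / t >= 1, so
    [mean_cos2_odd_angle] applies. At full weight sin(2 th) would vanish when all [d] indices are
    marked. *)
Lemma random_miss_le d t : (0 < t)%N -> (1 < d <= n)%N ->
  (forall p, marked p -> (p < d)%N) -> (t <= #|[pred p | marked p]|)%N ->
  random_miss d t <= 3 / 4.
Proof.
move=> t0 d1n md tm; have /andP[d1 dn] := d1n; set M := nb_iterations d t.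
have M0 : 0 < M%:R :> R by rewrite ltr0n.
have d0 : 0 < d%:R :> R by rewrite ltr0n ltnW.
have al1 : dot (damped d (1 / 2)) (damped d (1 / 2)) = 1.
  by apply: dot_damped; rewrite ?half_itv // (ltnW d1).
have [th hs [s0 c0]] := marked_angle O pr g al1.
rewrite /random_miss -/M mulrC ler_pdivrMr //.
rewrite (eq_bigr (fun K : 'I_M => cos (odd_angle K th) ^+ 2)) => [|K _]; last first.
  exact: miss_cos.
apply: mean_cos2_odd_angle.
have := card_marked_le dn md; set m := #|[pred p | marked p]| in tm * => md'.
have hS : sin th ^+ 2 = m%:R / d%:R / 2.
  rewrite -hs sum_marked_damped //; last by have /andP[] := half_itv.
  by field; rewrite gt_eqF.
have hM : d%:R / t%:R <= M%:R ^+ 2 :> R by apply: nb_iterations_ge.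
have x1 : m%:R / d%:R <= 1 :> R by rewrite ler_pdivrMr // mul1r ler_nat.
have x2 : 1 <= M%:R ^+ 2 * (m%:R / d%:R) :> R.
  rewrite (le_trans _ (ler_wpM2r _ hM)) ?divr_ge0 ?ler0n //.
  have -> : d%:R / t%:R * (m%:R / d%:R) = m%:R / t%:R :> R.
    by field; rewrite !pnatr_eq0 -!lt0n t0 (ltnW d1).
  by rewrite ler_pdivlMr ?ltr0n // mul1r ler_nat.
have x0 : 0 <= m%:R / d%:R :> R by rewrite divr_ge0 ?ler0n.
have q0 : 0 <= M%:R * sin (th *+ 2).
  by rewrite sin_mulr2n mulr_ge0 ?ler0n // mulrn_wge0 // mulr_ge0.
rewrite -(@ler_sqr _ 1) ?nnegrE // expr1n exprMn.
have -> : sin (th *+ 2) ^+ 2 = 4 * sin th ^+ 2 * (1 - sin th ^+ 2).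
  by rewrite sin_mulr2n -cos2sin2; ring.
rewrite hS (le_trans x2) // ler_wpM2l ?sqr_ge0 //.
move: x0 x1; set x := m%:R / _ => x0 x1; nra.
Qed.

End Search.

(** * Search with small error for an unknown number of marked indices *)

Section SmallErrorSearch.
Variables (R : realType) (n k : nat).
Local Notation prog := (program R n k (register n k)).
Local Notation nb_iterations := (nb_iterations R).
Implicit Types (yes no : prog) (d t : nat).

Section Correctness.
Variables (O : query n k -> answer n k) (pr : 'I_n.+1 -> protocol n k).
Variable g : 'I_n.+1 -> transcript n k -> bool.
Local Notation marked := (marked O pr g).
Local Notation branches := (@branches R n k O).

Lemma branches_foldr (A : nat -> prog -> prog -> prog) (f : nat -> R)
    (q : nat -> nat) A' f' q' (s : seq nat) :
  (forall t, t \in s -> branches (A t) (f t) (q t)) -> branches A' f' q' ->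
  branches (fun yes no => foldr (fun t => A t yes) (A' yes no) s)
    ((\prod_(t <- s) f t) * f') (\sum_(t <- s) q t + q').
Proof.
move=> + hA'; elim: s => [|t s IH] hA; first by rewrite !big_nil mul1r.
rewrite !big_cons -mulrA -addnA.
apply: (branches_seq (hA t (mem_head _ _))); apply: IH => u us.
by apply: hA; rewrite inE us orbT.
Qed.

Lemma branches_iter A f q m : branches A f q ->
  branches (fun yes no => iter m (A yes) no) (f ^+ m) (m * q).
Proof.
move=> hA; elim: m => [|m IH]; first exact: branches_no.
by rewrite exprS mulSn; apply: branches_seq IH.
Qed.

(* [t] marked indices are found by the exact attempt for [t] if [t <= t0], and
   by the random attempts with high probability if [t > t0]. *)
Definition search d t0 yes no : prog :=
  foldr (fun t => exact_attempt pr g d t yes)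
    (if (t0 < d)%N then iter (6 * t0) (random_attempt pr g d t0 yes) no else no)
    (iota 1 (minn t0 d)).

Definition search_cost d t0 : nat :=
  (\sum_(t <- iota 1 (minn t0 d)) (8 * nb_iterations d t + 4) +
   (if t0 < d then 6 * t0 * (8 * nb_iterations d t0) else 0))%N.

(** The error is one-sided: [yes] is entered only after the measured transcript has passed the test
    [g], so without marked indices every attempt misses. *)
Lemma searchP d t0 : (0 < t0)%N -> (1 < d <= n)%N ->
  (forall p, marked p -> (p < d)%N) ->
  exists f, [/\ branches (search d t0) f (search_cost d t0), 0 <= f,
    (forall p, ~~ marked p) -> f = 1
    & (exists p, marked p) -> f <= 4 ^- t0].
Proof.
move=> t0_gt0 d1n md; have /andP[d1 dn] := d1n.
have d0n : (0 < d <= n)%N by rewrite (ltnW d1).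
pose em := exact_miss R O pr g d; pose rm := random_miss R O pr g d t0.
have [rb /andP[rm0 rm1] r1] := random_attemptP R O pr g t0_gt0 d1n.
have emP t : t \in iota 1 (minn t0 d) -> (0 < t)%N.
  by rewrite mem_iota => /andP[].
have eb t : t \in iota 1 (minn t0 d) -> branches (exact_attempt pr g d t) (em t)
    (8 * nb_iterations d t + 4).
  by move=> /emP t_gt0; have [] := exact_attemptP R O pr g t_gt0 d0n.
have ei t : t \in iota 1 (minn t0 d) -> 0 <= em t <= 1.
  by move=> /emP t_gt0; have [] := exact_attemptP R O pr g t_gt0 d0n.
pose f' := if (t0 < d)%N then rm ^+ (6 * t0) else 1.
have f'0 : 0 <= f' by rewrite /f'; case: ifP; rewrite ?exprn_ge0 ?ler01.
exists ((\prod_(t <- iota 1 (minn t0 d)) em t) * f'); split.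
- rewrite /search /search_cost; apply: (branches_foldr eb).
  by rewrite /f'; case: ifP => _; [apply: branches_iter | apply: branches_no].
- rewrite mulr_ge0 // big_seq prodr_ge0 // => t /ei /andP[] //.
- move=> m0; rewrite big_seq big1 => [|t /emP t_gt0].
    by rewrite mul1r /f'; case: ifP => _ //; rewrite /rm r1 ?expr1n.
  by rewrite /em; have [_ _ ->] := exact_attemptP R O pr g t_gt0 d0n.
move=> [p mp]; set m := #|[pred p | marked p]|.
have m0 : (0 < m)%N by apply/card_gt0P; exists p.
have md' : (m <= d)%N := card_marked_le dn md.
(* In the first case the exact attempt for [m] contributes a factor 0. In the second, [m <= d]
   forces [t0 < m], and the random attempts do the work. *)
have [mt|tm] := leqP m (minn t0 d).
  have mi : m \in iota 1 (minn t0 d) by rewrite mem_iota m0 add1n ltnS.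
  rewrite (big_rem m) //= /em exact_miss0 // !mul0r.
  by rewrite invr_ge0 exprn_ge0.
have t0m : (t0 < m)%N.
  by move: tm; rewrite gtn_min => /orP[//|]; rewrite ltnNge md'.
rewrite (@le_trans _ _ f') //.
  rewrite -[leRHS]mul1r ler_wpM2r // big_seq prodr_ile1 // => t; exact: ei.
rewrite /f' (leq_trans t0m md') exprM -exprVn lerXn2r ?nnegrE ?invr_ge0 ?exprn_ge0 //.
(* Six misses in a row have probability at most (3/4)^6 < 1/4, whence the [6 * t0] repetitions. *)
rewrite (@le_trans _ _ ((3 / 4) ^+ 6)) //; last lra.
rewrite lerXn2r ?nnegrE ?divr_ge0 //.
exact: (random_miss_le R t0_gt0 d1n md (ltnW t0m)).
Qed.

End Correctness.

Lemma sum_sqrt_inv (d : R) (T : nat) : 0 <= d ->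
  \sum_(t <- iota 1 T) Num.sqrt (d / t%:R) <= 2 * Num.sqrt (d * T%:R).
Proof.
move=> d0; elim: T => [|T IH]; first by rewrite big_nil mulr_ge0 ?sqrtr_ge0.
rewrite -{1}[T.+1]addn1 iotaD big_cat big_seq1 /= add1n.
rewrite (le_trans (lerD IH (lexx _))) //.
rewrite !sqrtrM // sqrtrV ?ler0n // -subr_ge0.
have bp : 0 < Num.sqrt T.+1%:R :> R by rewrite sqrtr_gt0 ltr0n.
have b2 : Num.sqrt T.+1%:R ^+ 2 = T%:R + 1 :> R.
  by rewrite sqr_sqrtr ?ler0n // -addn1 natrD.
have a2 : Num.sqrt T%:R ^+ 2 = T%:R :> R by rewrite sqr_sqrtr ?ler0n.
move: bp b2 a2; set a := Num.sqrt T%:R; set b := Num.sqrt T.+1%:R => bp b2 a2.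
set s := Num.sqrt d.
(* As b^2 = a^2 + 1, the last factor is (b - a)^2. *)
have -> : 2 * (s * b) - (2 * (s * a) + s / b) = s / b * (2 * b ^+ 2 - 2 * a * b - 1).
  by field; rewrite gt_eqF.
rewrite mulr_ge0 ?divr_ge0 ?sqrtr_ge0 //.
have := sqr_ge0 (b - a); rewrite sqrrB; nra.
Qed.

Lemma search_cost_le d t0 : (0 < t0)%N -> (0 < d)%N ->
  (search_cost d t0)%:R <= 136 * Num.sqrt (d%:R * t0%:R) :> R.
Proof.
move=> t0_gt0 d0.
have dR : 0 <= d%:R :> R := ler0n _ _.
(* An exact attempt costs at most (8 * 2 + 4) sqrt(d / t), and summing over [t] doubles this to 40;
   the random attempts give 6 * 8 * 2 = 96. *)
have -> : 136 * Num.sqrt (d%:R * t0%:R) = 40 * Num.sqrt (d%:R * t0%:R) +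
  96 * Num.sqrt (d%:R * t0%:R) :> R by ring.
rewrite /search_cost natrD lerD //; last first.
  case: ifP => [td|_]; last by rewrite mulr_ge0 ?sqrtr_ge0.
  have h : (nb_iterations d t0)%:R <= 2 * Num.sqrt (d%:R / t0%:R) :> R.
    by rewrite nb_iterations_le // t0_gt0 ltnW.
  rewrite !natrM (le_trans (ler_wpM2l _ (ler_wpM2l _ h))) ?mulr_ge0 ?ler0n //.
  have t0R : 0 < t0%:R :> R by rewrite ltr0n.
  rewrite sqrtrM // sqrtrM // sqrtrV ?ler0n //.
  rewrite -{1}(sqr_sqrtr (ltW t0R)) le_eqVlt; apply/orP; left; apply/eqP.
  by field; rewrite gt_eqF // sqrtr_gt0.
have e t : t \in iota 1 (minn t0 d) ->
    (8 * nb_iterations d t + 4)%:R <= 20 * Num.sqrt (d%:R / t%:R) :> R.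
  rewrite mem_iota add1n ltnS leq_min => /and3P[t_gt0 _ td].
  have h : (nb_iterations d t)%:R <= 2 * Num.sqrt (d%:R / t%:R) :> R.
    by rewrite nb_iterations_le // t_gt0.
  have s1 : 1 <= Num.sqrt (d%:R / t%:R) :> R.
    rewrite -[leLHS]sqrtr1 ler_sqrt ?divr_ge0 ?ler0n //.
    by rewrite ler_pdivlMr ?mul1r ?ler_nat ?ltr0n.
  rewrite natrD natrM; lra.
rewrite natr_sum big_seq (le_trans (ler_sum _ (fun t ht => e t ht))) //.
rewrite -big_seq -mulr_sumr (le_trans (ler_wpM2l _ (sum_sqrt_inv _ dR))) //.
have : Num.sqrt (d%:R * (minn t0 d)%:R) <= Num.sqrt (d%:R * t0%:R) :> R.
  by rewrite ler_sqrt ?mulr_ge0 ?ler0n // ler_wpM2l // ler_nat geq_minl.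
lra.
Qed.

End SmallErrorSearch.

(** * Evaluating the DAG *)

Section DagFacts.
Variables (n k : nat) (G : aon_dag n k) (x : 'I_k -> bool).

Lemma size_out_le i : (size (out G i) <= n)%N.
Proof. by rewrite -(card_uniqP (out_uniq G i)) (leq_trans (max_card _)) ?card_ord. Qed.

Lemma oracle_val q : oracle G x q = oracle_nat G x q :> nat.
Proof.
rewrite /oracle inordK //; have nm := leq_maxl n k; have km := leq_maxr n k.
case: q => [|i|i p|i|i j|v] /=.
- by rewrite (leq_trans (ltn_ord _)) // leqW // leqW.
- by rewrite ltnS (leq_trans (size_out_le i)) // leqW.
- have [pd|dp] := ltnP p (size (out G i)); last first.
    by rewrite nth_default ?size_map // ltnS leqW.
  by rewrite (nth_map i) //= (leq_trans (ltn_ord _)) // leqW // leqW.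
- case: (label G i) => [||v] //=; rewrite !ltnS (leq_trans (ltn_ord v)) //.
- by case: (sigma G i j).
by case: (x v).
Qed.

(** As the sinks come last, the function-vertices form an initial segment, determined by its
    cardinality. *)
Lemma internalP i : (out G i != [::]) = (i < nb_internal G)%N.
Proof.
pose A := [set j | out G j != [::]].
have AE : nb_internal G = #|A|.
  rewrite /nb_internal -[X in (X - _)%N]card_ord -(cardsC (sinks G)) addKn.
  by apply: eq_card => j; rewrite !inE.
have down (j l : 'I_n) : (j <= l)%N -> l \in A -> j \in A.
  rewrite leq_eqVlt => /orP[/eqP/val_inj-> //|jl]; rewrite !inE.
  by apply: contraNneq => /(sinks_last jl) ->.
rewrite AE; apply/idP/idP => [iA|].
  rewrite -[leqLHS](card_ord_lt (ltn_ord i)); apply: subset_leq_card.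
  by apply/subsetP => j; rewrite inE ltnS => /down; apply; rewrite inE.
apply: contraTT => iA; rewrite -leqNgt -[leqRHS](card_ord_lt (ltnW (ltn_ord i))).
apply: subset_leq_card; apply/subsetP => j jA; rewrite inE ltnNge.
by apply/negP => /down /(_ jA); rewrite inE (negPf iA).
Qed.

Lemma size_out_gt1 (i : 'I_n) : (i < nb_internal G)%N -> (1 < size (out G i))%N.
Proof.
rewrite -internalP -size_eq0; have := @out_neq1 _ _ G i.
by case: (size _) => [|[|]].
Qed.

Lemma label_internal (i : 'I_n) : (i < nb_internal G)%N -> ~~ is_var (label G i).
Proof. by rewrite -internalP; apply: contra => /(@label_sink _ _ G i)/eqP. Qed.

(** [c] is the absorbing value of the connective, true for OR and false for AND; De Morgan turns AND
    into the same existential search. *)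
Lemma value_internal (i : 'I_n) : (i < nb_internal G)%N ->
  let c := oracle_nat G x (QLabel i) != 0%N in
  value G x i =
  if has (fun j => signed (sigma G i j) (value G x j) == c) (out G i)
  then c else ~~ c.
Proof.
move=> /label_internal; rewrite valueE /=; case: (label G i) => [||//] _ /=.
  rewrite -[LHS]negbK -has_predC /=.
  rewrite (eq_has (a2 := fun j => signed (sigma G i j) (value G x j) == false)).
    by case: has.
  by move=> j /=; rewrite eqbF_neg.
rewrite (eq_has (a2 := fun j => signed (sigma G i j) (value G x j) == true)).
  by case: has.
by move=> j /=; rewrite eqb_id.
Qed.

Lemma value_sink (i : 'I_n) : (nb_internal G <= i)%N ->
  exists2 v, label G i = LVar v & value G x i = x v.
Proof.
rewrite leqNgt -internalP negbK => /eqP/(@label_sink _ _ G i) hv.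
by move: hv; rewrite valueE; case: (label G i) => // v _; exists v.
Qed.

Lemma nb_edgesE : nb_edges G = (\sum_i size (out G i))%N.
Proof.
rewrite /nb_edges -sum1_card.
rewrite (eq_bigl (fun e : 'I_n * 'I_n => true && (e.2 \in out G e.1))); last first.
  by move=> e; rewrite inE.
rewrite -(pair_big_dep xpredT (fun i j => j \in out G i) (fun _ _ => 1%N)) /=.
by apply: eq_bigr => i _; rewrite sum1_card (card_uniqP (out_uniq G i)).
Qed.

End DagFacts.

(** Cauchy-Schwarz against the constant 1, read off the nonnegative double sum of the squared
    differences of the roots. *)
Lemma sum_sqrt_le (R : realType) (I : finType) (P : pred I) (F : I -> R) :
  (forall i, 0 <= F i) ->
  \sum_(i | P i) Num.sqrt (F i) <= Num.sqrt (#|P|%:R * \sum_(i | P i) F i).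
Proof.
move=> F0; set S := \sum_(i | P i) Num.sqrt _; set Q := \sum_(i | P i) F i.
have S0 : 0 <= S by apply: sumr_ge0 => i _; apply: sqrtr_ge0.
rewrite -[S]ger0_norm // -sqrtr_sqr ler_wsqrtr //.
have : 0 <= \sum_(i | P i) \sum_(j | P j) (Num.sqrt (F i) - Num.sqrt (F j)) ^+ 2.
  by apply: sumr_ge0 => i _; apply: sumr_ge0 => j _; apply: sqr_ge0.
suff -> : \sum_(i | P i) \sum_(j | P j) (Num.sqrt (F i) - Num.sqrt (F j)) ^+ 2 =
    2 * (#|P|%:R * Q - S ^+ 2) by lra.
transitivity (\sum_(i | P i) (#|P|%:R * F i + Q - 2 * S * Num.sqrt (F i))).
  apply: eq_bigr => i _; under eq_bigr do rewrite sqrrB !sqr_sqrtr //.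
  rewrite big_split /= sumrB sumr_const -mulr_natl -/Q.
  rewrite -[X in _ - X]/(\sum_(j | P j) _); under [X in _ - X + _]eq_bigr do
    rewrite -mulr_natl mulrA.
  by rewrite -mulr_sumr -/S; ring.
rewrite sumrB big_split /= -!mulr_sumr -/Q -/S sumr_const -mulr_natl; ring.
Qed.

(** * The evaluation program, its error and its cost *)

Section Evaluation.
Variables (R : realType) (n k : nat).
Local Notation prog := (program R n k (register n k)).

(** With no iteration and all the weight on the dummy index, a run is a deterministic sequence of
    queries. *)
Definition classical (pr : protocol n k) (cont : transcript n k -> prog) : prog :=
  run (fun=> pr) (fun _ _ => false) (fun p => (p == ord_max)%:R) 0
    (fun _ h => cont h).

Definition deg_label_protocol (i : 'I_n) : protocol n k :=
  Protocol (QDeg i) (fun _ => QLabel i) (fun _ _ => QRoot) (fun _ _ _ => QRoot).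

(** A protocol must react to every answer, including those that name no vertex; [QRoot] is then a
    harmless filler. *)
Definition ask_vertex (a : nat) (q : 'I_n -> query n k) : query n k :=
  if insub a is Some j then q j else QRoot.

(* Variables are labelled [v.+2]. *)
Definition ask_var (a : nat) : query n k :=
  if insub (a - 2)%N is Some v then QVar v else QRoot.

Definition child_protocol (i : 'I_n) (p : 'I_n.+1) : protocol n k :=
  Protocol (ask_vertex p (QNbr i)) (fun j => ask_vertex j (QSigma i))
    (fun j _ => ask_vertex j QLabel) (fun _ _ l => ask_var l).

Definition root_protocol : protocol n k :=
  Protocol QRoot (fun r => ask_vertex r QLabel) (fun _ l => ask_var l)
    (fun _ _ _ => QRoot).

Variables (nhat t0 : nat).

(* [tbl] records the values computed so far for the function-vertices. *)
Definition vertex_value (tbl : nat -> bool) (j : nat) (b : nat) : bool :=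
  if (j < nhat)%N then tbl j else b != 0%N.

(** The test [p < d] leaves the dummy index and the positions beyond the adjacency list unmarked. *)
Definition child_mark (tbl : nat -> bool) (d : nat) (c : bool)
    (p : 'I_n.+1) (h : transcript n k) : bool :=
  let: (j, s, _, b) := h in
  (p < d)%N && (signed ((s : nat) != 0%N) (vertex_value tbl j b) == c).

Definition set_value (tbl : nat -> bool) (j : nat) (b : bool) : nat -> bool :=
  fun l => if l == j then b else tbl l.

(* A vertex labelled OR ([c = true]) has value [c] iff some signed child has
   value [c], and so does a vertex labelled AND ([c = false]). *)
Fixpoint eval_dag (j : nat) (tbl : nat -> bool) : prog :=
  if j is j'.+1 then
    if insub j' is Some i then
      classical (deg_label_protocol i) (fun h =>
        let: (d, l, _, _) := h in
        let c := (l : nat) != 0%N in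
        search (child_protocol i) (child_mark tbl d c) d t0
          (eval_dag j' (set_value tbl j' c)) (eval_dag j' (set_value tbl j' (~~ c))))
    else Output _ _ _ _ true
  else classical root_protocol (fun h =>
    let: (r, _, b, _) := h in Output _ _ _ _ (vertex_value tbl r b)).

Variables (G : aon_dag n k) (x : 'I_k -> bool).
Local Notation O := (oracle G x).
Local Notation home := (ket R (home n k)).
Local Notation prob P b := (prob_output O P home b).
Local Notation time P := (nb_queries O P home).

Lemma dot_dummy :
  dot (fun p : 'I_n.+1 => (p == ord_max)%:R) (fun p => (p == ord_max)%:R) = 1 :> R.
Proof. by rewrite dot_delta eqxx. Qed.

Lemma prob_classical pr cont b :
  prob (classical pr cont) b = prob (cont (answers O (fun=> pr) ord_max)) b.
Proof.
rewrite /classical prob_output_run ?dot_dummy //.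
transitivity (\sum_(p < n.+1) (p == ord_max)%:R ^+ 2 *
    prob (cont (answers O (fun=> pr) ord_max)) b); first exact: eq_bigr.
by rewrite -mulr_suml -dotxx dot_dummy mul1r.
Qed.

Lemma time_classical pr cont T :
  (time (cont (answers O (fun=> pr) ord_max)) <= T)%N ->
  (time (classical pr cont) <= 4 + T)%N.
Proof.
move=> hT; apply: (nb_queries_run (fun _ _ => false) 0) => //; exact: dot_dummy.
Qed.

Hypothesis nhatE : nb_internal G = nhat.

Lemma ask_vertexE (j : 'I_n) q : ask_vertex j q = q j.
Proof. by rewrite /ask_vertex valK. Qed.

Lemma ask_varE (v : 'I_k) : ask_var v.+2 = QVar v.
Proof. by rewrite /ask_var subn2 /= valK. Qed.

Definition table_correct (j : nat) (tbl : nat -> bool) :=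
  forall i : 'I_n, (j <= i < nhat)%N -> tbl i = value G x i.

(** The answer [b] is constrained at sinks only: at a function-vertex the label names no variable,
    the last query is meaningless, and the table decides. *)
Lemma vertex_valueE tbl j (i : 'I_n) (b : nat) : table_correct j tbl -> (j <= i)%N ->
  (forall v, label G i = LVar v -> b = x v) ->
  vertex_value tbl i b = value G x i.
Proof.
move=> tc ji hb; rewrite /vertex_value; case: ltnP => [i_lt|].
  by rewrite tc // ji.
rewrite -nhatE => /(value_sink x)[v lv ->]; rewrite (hb v lv).
by case: (x v).
Qed.

Section Vertex.
Variables (i : 'I_n) (tbl : nat -> bool).
Hypothesis i_lt : (i < nhat)%N.
Let d := size (out G i).
Let c := oracle_nat G x (QLabel i) != 0%N.
Local Notation marked := (marked O (child_protocol i) (child_mark tbl d c)).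

Lemma marked_lt p : marked p -> (p < d)%N.
Proof. by case/andP. Qed.

Lemma marked_child (p : 'I_n.+1) (j0 : 'I_n) : table_correct i.+1 tbl -> (p < d)%N ->
  marked p = (signed (sigma G i (nth j0 (out G i) p))
                     (value G x (nth j0 (out G i) p)) == c).
Proof.
move=> tc pd; have pn : (p < n)%N := leq_trans pd (size_out_le G i).
set j := nth j0 (out G i) p.
have jo : j \in out G i by apply: mem_nth.
rewrite /marked /child_mark /= pd /=.
have -> : ask_vertex p (QNbr i) = QNbr i (Ordinal pn) :> query n k.
  by rewrite -(ask_vertexE (Ordinal pn)).
have a0 : oracle G x (QNbr i (Ordinal pn)) = j :> nat.
  by rewrite oracle_val /= (nth_map j0).
rewrite a0 !ask_vertexE.
have -> : (oracle G x (QSigma i j) : nat) != 0%N = sigma G i j.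
  by rewrite oracle_val /=; case: sigma.
rewrite (@vertex_valueE tbl i.+1 j) //; first by apply: out_topo jo.
move=> v lv; rewrite oracle_val /=.
by rewrite (_ : ask_var _ = QVar v) // oracle_val /= lv ask_varE.
Qed.

Lemma value_marked : table_correct i.+1 tbl ->
  value G x i = if [exists p, marked p] then c else ~~ c.
Proof.
move=> tc; rewrite value_internal ?nhatE // -/c; congr (if _ then _ else _).
apply/hasP/existsP => [[j jo hj]|[p mp]].
  have pd : (index j (out G i) < d)%N by rewrite index_mem.
  have pn : (index j (out G i) < n.+1)%N.
    by rewrite ltnS ltnW // (leq_trans pd (size_out_le G i)).
  by exists (Ordinal pn); rewrite (marked_child j) //= nth_index.
have pd := marked_lt mp; exists (nth i (out G i) p); first exact: mem_nth.
by rewrite -marked_child.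
Qed.

End Vertex.

Hypothesis t0_gt0 : (0 < t0)%N.

Lemma eval_dagS (i : 'I_n) tbl : (i < nhat)%N ->
  let d := size (out G i) in
  let c := oracle_nat G x (QLabel i) != 0%N in
  let S := search (child_protocol i) (child_mark tbl d c) d t0
    (eval_dag i (set_value tbl i c)) (eval_dag i (set_value tbl i (~~ c))) in
  (forall b, prob (eval_dag i.+1 tbl) b = prob S b) /\
  (forall T, (time S <= T)%N -> (time (eval_dag i.+1 tbl) <= 4 + T)%N).
Proof.
move=> i_lt d c S; rewrite [eval_dag i.+1 tbl]/= valK.
split=> [b|T hT]; first by rewrite prob_classical /= !oracle_val.
by apply: time_classical; rewrite /= !oracle_val.
Qed.

(** Union bound by induction: each vertex adds at most [4 ^- t0] to the error, provided the table
    passed on is correct. *)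
Lemma error_eval_dag j tbl : (j <= nhat)%N -> table_correct j tbl ->
  prob (eval_dag j tbl) (~~ dag_value G x) <= j%:R * 4 ^- t0.
Proof.
elim: j tbl => [|j IH] tbl j_le tc.
  rewrite mul0r [eval_dag 0 tbl]/= prob_classical /= oracle_val /=.
  rewrite ask_vertexE (@vertex_valueE tbl 0) //; last first.
    move=> v lv; rewrite oracle_val /=.
    by rewrite (_ : ask_var _ = QVar v) // oracle_val /= lv ask_varE.
  by rewrite /dag_value; case: (value G x _).
have jn : (j < n)%N by rewrite (leq_trans j_le) // -nhatE leq_subr.
pose i := Ordinal jn.
have [hp _] := eval_dagS tbl (i := i) j_le; rewrite hp {hp}.
set d := size (out G i); set c := _ != 0%N.
have d1n : (1 < d <= n)%N by rewrite size_out_gt1 ?nhatE // size_out_le.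
have [f [hf f0 f1 fs]] := searchP R t0_gt0 d1n (@marked_lt i tbl).
have vm := value_marked (i := i) j_le tc.
have tc' b : b = value G x i -> table_correct j (set_value tbl j b).
  move=> -> l /andP[jl ln]; rewrite /set_value; case: eqP => [lj|/eqP lj].
    by congr (value G x _); apply: val_inj.
  by apply: tc; rewrite ln ltn_neqAle eq_sym lj jl.
rewrite (hf _ _).1.
set Y := prob_output _ (eval_dag _ _) _ _; set N := prob_output _ (eval_dag _ _) _ _.
have Y0 : 0 <= Y by apply: prob_output_ge0.
have N1 : N <= 1 by rewrite (le_trans (prob_output_le _ _ _ _)) // sqnorm_ket.
have e0 : 0 <= 4 ^- t0 :> R by rewrite invr_ge0 exprn_ge0.
rewrite -[j.+1]addn1 natrD [leRHS]mulrDl [1 * 4 ^- t0]mul1r.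
(* With a marked child, the [yes] table is correct, and the wrong [no] branch, of error at most 1,
   is entered with probability at most [4 ^- t0]. *)
move: vm; case: (boolP [exists p, _]) => [/existsP ex vm|].
  have := fs ex; have : Y <= j%:R * 4 ^- t0.
    by apply: IH; [apply: ltnW | apply: tc'].
  nra.
(* Without a marked child, the search surely enters [no], whose table is correct. *)
rewrite negb_exists => /forallP /f1 -> vm.
have : N <= j%:R * 4 ^- t0 by apply: IH; [apply: ltnW | apply: tc'].
rewrite subrr mul0r add0r mul1r; lra.
Qed.

Definition vertex_cost (j : nat) : nat :=
  if insub j is Some i then (4 + search_cost R (size (out G i)) t0)%N else 0%N.

Lemma time_eval_dag j tbl : (j <= nhat)%N ->
  (time (eval_dag j tbl) <= \sum_(l < j) vertex_cost l + 4)%N.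
Proof.
elim: j tbl => [|j IH] tbl j_le.
  by rewrite big_ord0; apply: (time_classical (T := 0)).
have jn : (j < n)%N by rewrite (leq_trans j_le) // -nhatE leq_subr.
pose i := Ordinal jn.
have d1n : (1 < size (out G i) <= n)%N.
  by rewrite size_out_gt1 ?nhatE // size_out_le.
have [f [hf _ _ _]] := searchP R t0_gt0 d1n (@marked_lt i tbl).
have [_ ht] := eval_dagS tbl (i := i) j_le.
have cE : vertex_cost j = (4 + search_cost R (size (out G i)) t0)%N.
  by rewrite /vertex_cost (insubT (fun l => l < n)%N jn).
have e a b : (a + (4 + b) + 4 = 4 + (b + (a + 4)))%N by ring.
rewrite big_ord_recr [leqRHS]/= cE e; apply: ht.
by apply: (hf _ _).2; apply: IH; apply: ltnW.
Qed.

(** Each square root involved is at least 1 and absorbs the 4 queries of a classical protocol: 136 +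
    4 at each vertex, and 140 + 4 with the root. Cauchy-Schwarz sums the roots of the
    out-degrees. *)
Lemma total_cost_le : (1 < nhat)%N ->
  (\sum_(l < nhat) vertex_cost l + 4)%:R <=
  144 * Num.sqrt (nhat%:R * (nb_edges G)%:R * t0%:R) :> R.
Proof.
move=> nhat1; have nhat_le : (nhat <= n)%N by rewrite -nhatE leq_subr.
have tR : 1 <= t0%:R :> R by rewrite ler1n.
have e (i : 'I_n) : (i < nhat)%N ->
    (vertex_cost i)%:R <= 140 * Num.sqrt t0%:R * Num.sqrt (size (out G i))%:R :> R.
  move=> i_lt; have d1 : (0 < size (out G i))%N.
    by rewrite ltnW // size_out_gt1 ?nhatE.
  rewrite /vertex_cost valK natrD; have := search_cost_le R t0_gt0 d1.
  have : 1 <= Num.sqrt ((size (out G i))%:R * t0%:R) :> R.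
    by rewrite -[leLHS]sqrtr1 ler_wsqrtr // mulr_ege1 // ler1n.
  rewrite -mulrA [Num.sqrt t0%:R * _]mulrC -sqrtrM ?ler0n //; lra.
rewrite (big_ord_widen n vertex_cost) // natrD natr_sum.
have : \sum_(i < n | (i < nhat)%N) (vertex_cost i)%:R <=
    140 * Num.sqrt (nhat%:R * (nb_edges G)%:R * t0%:R) :> R.
  apply: le_trans (ler_sum _ e) _; rewrite -mulr_sumr -[leLHS]mulrA ler_wpM2l //.
  rewrite [leRHS]sqrtrM ?mulr_ge0 ?ler0n // mulrC ler_wpM2r ?sqrtr_ge0 //.
  apply: le_trans (sum_sqrt_le _ _) _ => //.
  rewrite card_ord_lt // ler_wsqrtr // ler_wpM2l // nb_edgesE natr_sum.
  by rewrite [leRHS](bigID (fun i : 'I_n => (i < nhat)%N)) /= lerDl sumr_ge0.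
have : 1 <= Num.sqrt (nhat%:R * (nb_edges G)%:R * t0%:R) :> R.
  rewrite -[leLHS]sqrtr1 ler_wsqrtr // -!natrM ler1n !muln_gt0 t0_gt0 (ltnW nhat1).
  have n0 : (0 < n)%N by rewrite (leq_trans _ nhat_le) // ltnW.
  rewrite andbT nb_edgesE (bigD1 (Ordinal n0)) //= addn_gt0.
  by rewrite ltnW // size_out_gt1 // nhatE ltnW.
lra.
Qed.

End Evaluation.

(** * Choice of the error parameter from the number of function-vertices *)

Section LogBounds.
Variable R : realType.

(** With [l] the truncated logarithm, 2^l <= N bounds [l * ln 2], and [l.+1 <= 2 * l] because [N] is
    at least 2. *)
Lemma trunc_log_le_ln (N : nat) : (1 < N)%N ->
  (trunc_log 2 N).+1%:R <= 2 / ln 2 * ln N%:R :> R.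
Proof.
move=> N1; set l := trunc_log 2 N.
have l0 : (0 < l)%N by rewrite trunc_log_gt0.
have ln2 : 0 < ln 2 :> R by rewrite ln_gt0 // ltr1n.
have : l%:R * ln 2 <= ln N%:R :> R.
  rewrite mulr_natl -lnXn ?ltr0n // ler_ln ?posrE ?exprn_gt0 ?ltr0n ?(ltnW N1) //.
  by rewrite -natrX ler_nat trunc_logP // ltnW.
have : l.+1%:R <= 2 * l%:R :> R by rewrite -natrM ler_nat mul2n -addnn -addn1 leq_add2l.
move=> h1 h2; rewrite mulrAC ler_pdivlMr //; nra.
Qed.

(** As N < 2^(l + 1), squaring gives N^2 < 4^(l + 1): this parameter makes the union bound at most 1
    / N. *)
Lemma pow4_trunc_log (N : nat) : (0 < N)%N ->
  N%:R * 4 ^- (trunc_log 2 N).+1 <= 1 / N%:R :> R.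
Proof.
move=> N0; have NR : 0 < N%:R :> R by rewrite ltr0n.
rewrite ler_pdivlMr // mulrAC ler_pdivrMr ?exprn_gt0 // mul1r -expr2.
have -> : 4 = 2 ^+ 2 :> R by rewrite -natrX.
rewrite -exprM mulnC exprM ler_sqr ?nnegrE ?exprn_ge0 ?ler0n //.
by rewrite -natrX ler_nat ltnW // trunc_log_ltn.
Qed.

End LogBounds.

(** For [nhat = 1] the logarithm vanishes and the time bound allows no query at all, while the error
    bound is 1; a constant output meets both. *)
Definition dag_algorithm (R : realType) (n k nhat : nat) : quantum_algorithm R n k :=
  QuantumAlgorithm (home n k)
    (if (nhat <= 1)%N then Output R n k _ true
     else eval_dag R n k nhat (trunc_log 2 nhat).+1 nhat (fun=> false)).

Theorem theorem1 (R : realType) :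
  exists A : forall n k nhat : nat, quantum_algorithm R n k,
  exists c : R, exists c' : R,
  forall (n k nhat : nat), (0 < nhat)%N ->
  forall (G : aon_dag n k) (x : 'I_k -> bool), nb_internal G = nhat ->
    [/\ (running_time (A n k nhat) G x)%:R <=
          c * Num.sqrt (nhat%:R * (nb_edges G)%:R * ln nhat%:R),
        (running_time (A n k nhat) G x)%:R <=
          c * Num.sqrt (n%:R * (nb_edges G)%:R * ln n%:R)
      & error_probability (A n k nhat) G x <= c' / nhat%:R].
Proof.
exists (dag_algorithm R), (144 * Num.sqrt (2 / ln 2)), 1 => n k nhat nhat0 G x hE.
set c := 144 * _.
have ln2 : 0 < ln 2 :> R by rewrite ln_gt0 // ltr1n.
have c0 : 0 <= c by rewrite mulr_ge0 ?sqrtr_ge0.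
have nhat_le : (nhat <= n)%N by rewrite -hE leq_subr.
have mono : c * Num.sqrt (nhat%:R * (nb_edges G)%:R * ln nhat%:R) <=
    c * Num.sqrt (n%:R * (nb_edges G)%:R * ln n%:R).
  rewrite ler_wpM2l // ler_wsqrtr // ler_pM ?mulr_ge0 ?ler0n ?ln_ge0 ?ler1n //.
    by rewrite ler_wpM2r ?ler0n // ler_nat.
  by rewrite ler_ln ?posrE ?ltr0n ?ler_nat // (leq_trans nhat0).
suff [rt er] : (running_time (dag_algorithm R n k nhat) G x)%:R <=
      c * Num.sqrt (nhat%:R * (nb_edges G)%:R * ln nhat%:R) /\
    error_probability (dag_algorithm R n k nhat) G x <= 1 / nhat%:R.
  by split=> //; apply: le_trans rt mono.
rewrite /running_time /error_probability /dag_algorithm /=.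
have [nhat1|nhat1] := leqP nhat 1.
  have -> : nhat = 1%N by apply/eqP; rewrite eqn_leq nhat1.
  split; first by rewrite mulr_ge0 ?sqrtr_ge0.
  by rewrite divr1 (le_trans (prob_output_le _ _ _ _)) // sqnorm_ket.
have t0 : (0 < (trunc_log 2 nhat).+1)%N by [].
split; last first.
  apply: le_trans (pow4_trunc_log R nhat0).
  (* The initial table is vacuously correct, no function-vertex having an index at least [nhat]. *)
  apply: error_eval_dag => // i /andP[ji ij].
  by rewrite ltnNge ji in ij.
apply: le_trans (_ : _ <=
  (\sum_(l < nhat) vertex_cost R (trunc_log 2 nhat).+1 G l + 4)%:R) _.
  by rewrite ler_nat; apply: time_eval_dag.
apply: le_trans (total_cost_le _ hE t0 nhat1) _.
(* The factor sqrt(2 / ln 2) of [c] pays for replacing the error parameter by [ln nhat]. *)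
rewrite /c -[leRHS]mulrA ler_wpM2l // -sqrtrM; last by rewrite divr_ge0 // ltW.
rewrite ler_wsqrtr // [leRHS]mulrCA ler_wpM2l ?mulr_ge0 ?ler0n //.
exact: trunc_log_le_ln.
Qed.
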